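(* Let $n\ge2$. For every integer $2\le d\le n+1$, the function $v\mapsto g_d(v_n)$ on $S^{n-1}$ is integrable with respect to $S_{n+1-d}(K)$ for every $K\in\mathcal{K}(\mathbb{R}^n)$, where $g_d$ denotes Berg's function in dimension $d$.
   Context: $\mathcal{K}(\mathbb{R}^n)$ is the space of convex bodies (non-empty compact convex subsets of $\mathbb{R}^n$). $v_n=\langle v,e_n\rangle$. $S_j(K)=S_j(K,\cdot)$ is the $j$th area measure of $K$ on $S^{n-1}$, $0\le j\le n-1$, normalized by the local Steiner formula: for $\rho>0$ and Borel $\omega\subset S^{n-1}$, the set of $x\notin K$ with $d(x,K)\le\rho$ and $\frac{x-p(K,x)}{|x-p(K,x)|}\in\omega$ ($p(K,\cdot)$ the nearest point projection) has volume $\frac1n\sum_{j=0}^{n-1}\rho^{n-j}\binom nj S_j(K,\omega)$. In particular $S_0(K)$ is spherical Lebesgue measure. Berg's function $g_d$, $d\ge2$, is the continuous function $g_d:[-1,1)\to\mathbb{R}$ (extending continuously to $[-1,1]$ for $d=2$, and diverging to $-\infty$ as $t\to1$ for $d\ge3$) from Berg's solution of the Christoffel problem: a centered measure $\mu$ on $S^{d-1}$ is the first area measure of a convex body in $\mathbb{R}^d$ if and only if $\int_{S^{d-1}}g_d(\langle\cdot,v\rangle)d\mu(v)$ (understood as a spherical convolution) is a support function. Explicitly, $g_d$ is the function, continuous on $[-1,1)$, with $\int_{-1}^1|g_d(t)|(1-t^2)^{\frac{d-3}2}dt<\infty$ and $\int_{-1}^1 t\,g_d(t)(1-t^2)^{\frac{d-3}2}dt=0$,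 such that for every $\varphi\in C^\infty(S^{d-1})$ and $u\in S^{d-1}$, $\int_{S^{d-1}}g_d(\langle u,v\rangle)\left(\varphi(v)+\frac1{d-1}\Delta_{S^{d-1}}\varphi(v)\right)dv=\varphi(u)-(\pi_1\varphi)(u)$, where $\pi_1$ is the $L^2$-orthogonal projection onto the restrictions of linear functionals to $S^{d-1}$ and $dv$ is spherical Lebesgue measure. For $d\ge3$ the function $v\mapsto g_d(v_n)$ is defined on $S^{n-1}\setminus\{e_n\}$ and assigned an arbitrary real value at $e_n$. *)

(* Defs.v *)
From HB Require Import structures.
From mathcomp Require Import all_boot all_order all_algebra.
From mathcomp Require Import all_classical all_reals all_analysis.
From mathcomp Require Import measurable_realfun.
Set Implicit Arguments.
Unset Strict Implicit.
Unset Printing Implicit Defensive.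
Import Order.TTheory GRing.Theory Num.Theory.
Import numFieldNormedType.Exports.
Local Open Scope classical_set_scope.
Local Open Scope ring_scope.

(* The Borel sigma-algebra on matrices, hence on R^n = 'rV[R]_n. *)
HB.instance Definition _ (R : realType) (m n : nat) :=
  @isMeasurable.Build (sigma_display (@open 'M[R]_(m, n)))
    'M[R]_(m, n) <<s @open 'M[R]_(m, n) >>
    (@sigma_algebra0 _ setT _) (@sigma_algebraC _ _)
    (@sigma_algebra_bigcup _ setT _).

Section borel.
Context {R : realType}.

Lemma measurable_coord (n : nat) (i : 'I_n) :
  measurable_fun [set: 'rV[R]_n] (fun v : 'rV[R]_n => v ord0 i).
Proof.
apply: (measurability _ (RGenOpens.measurableE R)) => _ [_ [x [y ->]] <-].
apply: sub_sigma_algebra; rewrite setTI.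
have /continuousP := @coord_continuous R 1 n ord0 i.
by apply; exact: interval_open.
Qed.

Lemma open_rV_bigcup_box (n : nat) (U : set 'rV[R]_n) : open U ->
  U = \bigcup_(p in [set p : 'rV[rat]_n * rat |
      ball (map_mx ratr p.1 : 'rV[R]_n) (ratr p.2) `<=` U])
    ball (map_mx ratr p.1 : 'rV[R]_n) (ratr p.2).
Proof.
move=> oU; rewrite eqEsubset; split=> [x Ux|x [p /= pU xp]]; last exact: pU.
have /nbhs_ballP[e /= e0 eU] : nbhs x U by exact: open_nbhs_nbhs.
have [r] : exists r : rat, ratr r \in `]0, e / 2[%R.
  by apply: rat_in_itvoo; rewrite divr_gt0.
rewrite in_itv/= => /andP[r0 re].
have [q qP] : exists q : 'I_n -> rat, forall i, `|ratr (q i) - x ord0 i| < ratr r :> R.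
  apply: (@fin_all_exists _ _ (fun i s => `|ratr s - x ord0 i| < ratr r :> R)) => i.
  have [s] : exists s : rat, ratr s \in `]x ord0 i - ratr r, x ord0 i + ratr r[%R.
    by apply: rat_in_itvoo; rewrite ltrD2l gtrN.
  by rewrite in_itv/= -ltr_distlC distrC => H; exists s.
have xb : ball (map_mx ratr (\row_i q i) : 'rV[R]_n) (ratr r) x.
  by split => // i j; rewrite !mxE (ord1 i) /ball/=; exact: qP.
exists (\row_i q i, r) => //= y yb; apply: eU.
have re2 := ltW re; exact: ball_splitr (le_ball re2 xb) (le_ball re2 yb).
Qed.

Lemma measurable_fun_rV d (T : measurableType d) (n : nat) (f : T -> 'rV[R]_n) :
  (forall i, measurable_fun [set: T] (fun x => f x ord0 i)) ->
  measurable_fun [set: T] f.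
Proof.
move=> mf; apply: (@measurability _ _ T 'rV[R]_n setT f (@open 'rV[R]_n)) => //.
move=> _ [U oU <-]; rewrite (open_rV_bigcup_box oU) setTI preimage_bigcup.
rewrite bigcup_mkcond; apply: countable_bigcupT_measurable => [|p].
  by apply: countableP.
case: ifPn => // _.
have [e0|e0] := ltP 0 (ratr p.2 : R); last first.
  rewrite [X in measurable X](_ : _ = set0)//.
  by rewrite -subset0 => x [/lt_le_trans /(_ e0)]; rewrite ltxx.
rewrite [X in measurable X](_ : _ = \big[setI/setT]_(i < n)
   ((fun x => f x ord0 i) @^-1` ball (ratr (p.1 ord0 i) : R) (ratr p.2))).
  apply: bigsetI_measurable => i _; rewrite -[X in measurable X]setTI.
  by apply: mf => //; exact: measurable_ball.
rewrite -bigcap_seq; apply/seteqP; split => [x [_ H] i _|x H].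
  by have := H ord0 i; rewrite mxE.
split=> // i j; rewrite (ord1 i) mxE; apply: H => /=; rewrite mem_index_enum.
by [].
Qed.

End borel.

Section euclidean.
Context {R : realType} {n : nat}.
Implicit Types x y : 'rV[R]_n.

(* The library norm `|x| on 'rV[R]_n is the sup norm; enorm is the Euclidean
   norm. Both induce the same topology. *)
Definition dot x y : R := \sum_i x ord0 i * y ord0 i.

Definition enorm x : R := Num.sqrt (dot x x).

Definition sphere : set 'rV[R]_n := [set v | enorm v = 1].

Definition direction x : 'rV[R]_n := (enorm x)^-1 *: x.

(* e_n, i.e. the coordinate vector of the last index n.-1. *)
Definition e_last : 'rV[R]_n := \row_i (i.+1 == n)%:R.

Lemma measurable_dot y : measurable_fun [set: 'rV[R]_n] (dot ^~ y).
Proof.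
apply: measurable_sum => i; apply: measurable_funM => //.
exact: measurable_coord.
Qed.

Lemma measurable_enorm : measurable_fun [set: 'rV[R]_n] enorm.
Proof.
apply: (@measurableT_comp _ _ _ _ _ _ (@Num.sqrt R)).
  by apply: continuous_measurable_fun; exact: sqrt_continuous.
by apply: measurable_sum => i; apply: measurable_funM; exact: measurable_coord.
Qed.

Lemma measurable_inv : measurable_fun [set: R] (@GRing.inv R).
Proof.
rewrite -(setvU [set 0]); apply/measurable_funU => //; first exact: measurableC.
split; last exact: measurable_fun_set1.
apply: open_continuous_measurable_fun; first by rewrite openC; exact: closed_eq.
by move=> x /set_mem/eqP x0; exact: inv_continuous.
Qed.

Lemma measurable_direction : measurable_fun [set: 'rV[R]_n] direction.
Proof.
apply: measurable_fun_rV => i; under eq_fun do rewrite mxE.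
apply: measurable_funM; last exact: measurable_coord.
exact: measurableT_comp measurable_inv measurable_enorm.
Qed.

Lemma measurable_eball :
  measurable [set x : 'rV[R]_n | 0 < enorm x <= 1].
Proof.
rewrite [X in measurable X](_ : _ = setT `&` enorm @^-1` `]0, 1]%classic).
  by apply: measurable_enorm.
by rewrite setTI; apply/seteqP; split => x /=; rewrite in_itv.
Qed.

End euclidean.
Arguments sphere {R} n.
Arguments e_last {R} n.

Section lebesgue_cons.
Context {R : realType} {n : nat}.
Variable mu : {sigma_finite_measure set 'rV[R]_n -> \bar R}.

Let cons (p : measurableTypeR R * 'rV[R]_n) : 'rV[R]_n.+1 :=
  row_mx p.1%:M p.2 : 'rV[R]_(1 + n).

Let uncons (v : 'rV[R]_(1 + n)) : measurableTypeR R * 'rV[R]_n :=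
  (lsubmx v ord0 ord0, rsubmx v).

Let consK : cancel cons uncons.
Proof. by move=> [x v]; rewrite /uncons /cons row_mxKl row_mxKr mxE eqxx. Qed.

Let measurable_cons : measurable_fun setT cons.
Proof.
apply: measurable_fun_rV => i; rewrite /cons.
case: (@splitP 1 n i) => j ij.
  have -> : i = lshift n j by exact: val_inj.
  rewrite [X in measurable_fun _ X](_ : _ = fst)//; apply/funext => p.
  by apply: etrans (row_mxEl _ _ _ _) _; rewrite (ord1 j) mxE eqxx.
have -> : i = rshift 1 j by exact: val_inj.
rewrite [X in measurable_fun _ X](_ : _ = (fun v : 'rV[R]_n => v ord0 j) \o snd).
  exact: measurableT_comp (measurable_coord j) measurable_snd.
by apply/funext => p; exact: row_mxEr.
Qed.

Let measurable_uncons : measurable_fun setT uncons.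
Proof.
apply/measurable_fun_pair => /=.
  by under eq_fun do rewrite mxE; exact: measurable_coord.
apply: measurable_fun_rV => i; under eq_fun do rewrite mxE.
exact: measurable_coord.
Qed.

Definition lebesgue_cons : set 'rV[R]_n.+1 -> \bar R :=
  pushforward (@lebesgue_measure R \x mu)%E
    (fun p => row_mx p.1%:M p.2 : 'rV[R]_(1 + n)).

Let m0 : lebesgue_cons set0 = 0%E.
Proof. by rewrite /lebesgue_cons /pushforward preimage_set0 measure0. Qed.

Let m_ge0 A : (0 <= lebesgue_cons A)%E.
Proof. exact: measure_ge0. Qed.

Let m_sigma_additive : semi_sigma_additive lebesgue_cons.
Proof.
move=> F mF tF mUF; rewrite /lebesgue_cons /pushforward preimage_bigcup.
apply: measure_semi_sigma_additive.
- by move=> k; rewrite -[X in measurable X]setTI; exact: measurable_cons.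
- apply/trivIsetP => /= i j _ _ ij; rewrite -preimage_setI.
  by move/trivIsetP : tF => /(_ _ _ _ _ ij) ->//; rewrite preimage_set0.
- by rewrite -preimage_bigcup -[X in measurable X]setTI; exact: measurable_cons.
Qed.

HB.instance Definition _ :=
  isMeasure.Build _ _ _ lebesgue_cons m0 m_ge0 m_sigma_additive.

Let m_sigma_finite : sigma_finite setT lebesgue_cons.
Proof.
have /sigma_finiteP[F [FT ndF Foo]] := sigma_finiteT (@lebesgue_measure R).
have /sigma_finiteP[G [GT ndG Goo]] := sigma_finiteT mu.
exists (fun k => uncons @^-1` (F k `*` G k)).
  rewrite -preimage_bigcup; apply/seteqP; split=> // v _ /=.
  have [i _ Fi] : (\bigcup_i F i) (uncons v).1 by rewrite -FT.
  have [j _ Gj] : (\bigcup_i G i) (uncons v).2 by rewrite -GT.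
  exists (maxn i j) => //; split.
    by move: Fi; apply/subsetPset/ndF/leq_maxl.
  by move: Gj; apply/subsetPset/ndG/leq_maxr.
move=> k; have [mFk Fkoo] := Foo k; have [mGk Gkoo] := Goo k; split.
  rewrite -[X in measurable X]setTI; apply: measurable_uncons => //.
  exact: measurableX.
rewrite /lebesgue_cons /pushforward -comp_preimage.
rewrite (_ : _ @^-1` _ = F k `*` G k).
  by rewrite product_measure1E// lte_mul_pinfty// ge0_fin_numE.
by rewrite (_ : _ \o _ = id)//; apply/funext => p; exact: consK.
Qed.

HB.instance Definition _ :=
  Measure_isSigmaFinite.Build _ _ _ lebesgue_cons m_sigma_finite.

End lebesgue_cons.

(* The first coordinate is split off at each step: 'rV_m.+1 = R * 'rV_m. *)
Fixpoint lebesgue_rV (R : realType) (n : nat) :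
    {sigma_finite_measure set 'rV[R]_n -> \bar R} :=
  match n with
  | 0 => [the {sigma_finite_measure set _ -> \bar R} of \d_(0 : 'rV[R]_0)]
  | m.+1 => [the {sigma_finite_measure set _ -> \bar R} of
              lebesgue_cons (lebesgue_rV R m)]
  end.

Section spherical_lebesgue.
Context {R : realType} (n : nat).

(* Surface measure in polar coordinates: n times the volume of the cone
   {r v : 0 < r <= 1, v in A}. *)
Definition sphere_measure : set 'rV[R]_n -> \bar R := fun A =>
  (n%:R%:E * lebesgue_rV R n
    ([set x : 'rV[R]_n | (0 < enorm x <= 1)%R] `&` direction @^-1` A))%E.

Let m0 : sphere_measure set0 = 0%E.
Proof.
by rewrite /sphere_measure preimage_set0 setI0 measure0 mule0.
Qed.

Let m_ge0 A : (0 <= sphere_measure A)%E.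
Proof. by rewrite /sphere_measure mule_ge0// lee_fin. Qed.

Let m_sigma_additive : semi_sigma_additive sphere_measure.
Proof.
move=> F mF tF mUF; rewrite /sphere_measure preimage_bigcup setI_bigcupr.
under eq_fun do rewrite -ge0_sume_distrr//.
apply: cvgeZl => //; apply: measure_semi_sigma_additive.
- move=> k; apply: measurableI; first exact: measurable_eball.
  by rewrite -[X in measurable X]setTI; exact: measurable_direction.
- apply/trivIsetP => /= i j _ _ ij; rewrite setIACA -preimage_setI.
  by move/trivIsetP : tF => /(_ _ _ _ _ ij) ->//; rewrite preimage_set0 setI0.
- rewrite -setI_bigcupr -preimage_bigcup.
  apply: measurableI; first exact: measurable_eball.
  by rewrite -[X in measurable X]setTI; exact: measurable_direction.
Qed.

HB.instance Definition _ :=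
  isMeasure.Build _ _ _ sphere_measure m0 m_ge0 m_sigma_additive.

End spherical_lebesgue.
Arguments sphere_measure {R} n.

Section area_measures.
Context {R : realType} {n : nat}.
Implicit Types (K w : set 'rV[R]_n) (x : 'rV[R]_n).

Definition convex_body K := [/\ K !=set0, compact K & convex_set K].

Definition edist x K : R := inf [set enorm (x - q) | q in K].

Definition metric_proj K x : 'rV[R]_n :=
  xget 0 [set p | K p /\ forall q, K q -> enorm (x - p) <= enorm (x - q)].

Definition local_parallel_set K (rho : R) w : set 'rV[R]_n :=
  [set x | [/\ ~ K x, edist x K <= rho & w (direction (x - metric_proj K x))]].

(* Measures on S^(n-1) are represented by Borel measures on R^n concentrated on
   the sphere. Only the S j with j < n are relevant; the Steiner formula
   determines them uniquely, comparing coefficients of powers of rho. *)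
Definition area_measures K (S : nat -> {measure set 'rV[R]_n -> \bar R}) :=
  (forall j, (j < n)%N -> S j (~` sphere n) = 0%E) /\
  (forall (rho : R) w, 0 < rho -> measurable w -> w `<=` sphere n ->
     lebesgue_rV R n (local_parallel_set K rho w) =
     ((n%:R^-1)%:E *
       \sum_(j < n) (rho ^+ (n - j) * 'C(n, j)%:R)%:E * S j w)%E).

End area_measures.

Section spherical_calculus.
Context {R : realType} {d : nat}.
Implicit Types (phi p : 'rV[R]_d -> R) (U : set 'rV[R]_d).

Fixpoint Ck (k : nat) U (f : 'rV[R]_d -> R) : Prop :=
  (forall x, U x -> {for x, continuous f}) /\
  if k is k'.+1 then
    forall i : 'I_d, (forall x, U x -> derivable f x 'e_i) /\
                     Ck k' U (fun x => 'D_('e_i) f x)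
  else True.

(* Functions on S^(d-1) are represented by functions on R^d, of which only the
   values on the sphere matter; calculus on the sphere is expressed through the
   0-homogeneous extension x |-> phi (x / |x|) to R^d \ {0}. *)
Definition radial_ext phi : 'rV[R]_d -> R := fun x => phi (direction x).

Definition smooth_sphere phi := forall k, Ck k [set x | x != 0] (radial_ext phi).

(* On the sphere, the Laplace-Beltrami operator is the Euclidean Laplacian of
   the 0-homogeneous extension. *)
Definition sphere_laplacian phi (v : 'rV[R]_d) : R :=
  \sum_(i < d) 'D_('e_i) (fun x => 'D_('e_i) (radial_ext phi) x) v.

(* p is the L2-orthogonal projection of phi onto the restrictions to the sphere
   of linear functionals. *)
Definition linear_proj phi p :=
  (exists a, forall v, sphere d v -> p v = dot a v) /\
  (forall b, \int[sphere_measure d]_(v in sphere d)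
               ((phi v - p v) * dot b v) = 0).

End spherical_calculus.

(* Berg's function in dimension d, as a total function R -> R constrained on
   [-1, 1[ only; in particular g 1 is arbitrary. *)
Definition berg_function {R : realType} (d : nat) (g : R -> R) :=
  let weight (t : R) : R := (1 - t ^+ 2) `^ ((d%:R - 3) / 2) in
  let I : set R := `]-1, 1[%classic in
  [/\ {within `[-1, 1[, continuous g},
      (\int[lebesgue_measure]_(t in I)
         (`|g t| * weight t)%:E < +oo)%E,
      \int[lebesgue_measure]_(t in I) (t * g t * weight t) = 0 &
      forall phi p : 'rV[R]_d -> R, smooth_sphere phi -> linear_proj phi p ->
        forall u, sphere d u ->
          \int[sphere_measure d]_(v in sphere d)
             (g (dot u v) * (phi v + (d.-1%:R)^-1 * sphere_laplacian phi v))
          = phi u - p u].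

(* Main.v *)
Require Import Defs.
From HB Require Import structures.
From mathcomp Require Import all_boot all_order all_algebra.
From mathcomp Require Import all_classical all_reals all_analysis.
From mathcomp Require Import measurable_realfun ring lra.
Set Implicit Arguments.
Unset Strict Implicit.
Unset Printing Implicit Defensive.
Import Order.TTheory GRing.Theory Num.Theory.
Import numFieldNormedType.Exports.
Local Open Scope classical_set_scope.
Local Open Scope ring_scope.

(** Put [m = d - 1] and [j = n + 1 - d], so that [n - j = m]. At angular
distance [r] from [e_n], Berg's function [g] has a singularity of order at most
[r^(2 - m)] (logarithmic if [m = 2], absent if [m = 1]), whereas the area
measure [S_j] gives the cap of radius [r] around [e_n] a mass of order [r^(m-1)].
Summed over the caps of radius [2^-i], the increments of [g] times the masses
of the caps form a geometric series of ratio [1/2].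

Mass of the caps ([area_cap_le]). All terms of the Steiner polynomial are
nonnegative, so [S_j(w)] is at most a constant times [rho^(j - n)] times the
volume of the local parallel set of radius [rho] over [w], for every [rho].
Over a cap of radius [1 / rho] this set leaves [K] in almost vertical
directions; it lies in a box that is bounded independently of [rho] except for
its height, of order [rho]. Hence [S_j(w)] is of order [rho^(1 - m)].

Growth of [g] ([berg_growth]). Testing the identity that defines [g] on zonal
functions [f(<u, v>)], where [f] vanishes outside a compact part of (0, 1),
turns it into an identity between integrals over (0, 1)
([zonal_integral], [sphere_laplacian_zonal]): the distribution [g] solves a
second order equation in which [f] enters through
[(P f')' + m w f], where [P = (1 - t^2)^(m/2)] and [w = (1 - t^2)^((m-2)/2)].
Since [f = t] is annihilated, substituting [f = t h] leaves
[t^-1 (t^2 P h')'] ([self_adjoint_form]), so [k = t^2 P h'] may be taken to be a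
smooth approximation of the indicator of an interval [[t1, t2]], corrected by
a fixed bump to make [h] compactly supported. The identity then compares the
averages of [g(t) / t] near [t1] and near [t2], and the comparison is as good
as [h] is small: [|h|] is at most the integral of [1 / (t^2 P)] over
[[t1, t2]], and the contribution of the linear projection of [t h] is at most
[sup |h|] ([linear_proj_zonal]). *)

(** * Euclidean vectors *)

Section euclidean_vectors.
Context {R : realType} {n : nat}.
Implicit Types x y z : 'rV[R]_n.

Lemma dot_ge0 x : 0 <= dot x x.
Proof. by apply: sumr_ge0 => i _; rewrite -expr2 sqr_ge0. Qed.

Lemma dot_gt0 x : x != 0 -> 0 < dot x x.
Proof.
move=> x0; rewrite lt_neqAle dot_ge0 andbT eq_sym; apply: contra x0.
rewrite psumr_eq0 => [/allP H|i _]; last by rewrite -expr2 sqr_ge0.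
apply/eqP/matrixP => i j; rewrite (ord1 i) mxE; apply/eqP.
by have := H j (mem_index_enum _); rewrite -expr2 sqrf_eq0.
Qed.

Lemma dotC x y : dot x y = dot y x.
Proof. by apply: eq_bigr => i _; rewrite mulrC. Qed.

Lemma dotDl x y z : dot (x + y) z = dot x z + dot y z.
Proof. by rewrite /dot -big_split; apply: eq_bigr => i _; rewrite mxE mulrDl. Qed.

Lemma dotZl (c : R) x y : dot (c *: x) y = c * dot x y.
Proof. by rewrite /dot mulr_sumr; apply: eq_bigr => i _; rewrite mxE mulrA. Qed.

Lemma dotNl x y : dot (- x) y = - dot x y.
Proof. by rewrite -scaleN1r dotZl mulN1r. Qed.

Lemma dotDr x y z : dot z (x + y) = dot z x + dot z y.
Proof. by rewrite dotC dotDl !(dotC z). Qed.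

Lemma dotZr (c : R) x y : dot x (c *: y) = c * dot x y.
Proof. by rewrite dotC dotZl (dotC y). Qed.

Lemma dotNr x y : dot x (- y) = - dot x y.
Proof. by rewrite dotC dotNl (dotC y). Qed.

Lemma enorm_ge0 x : 0 <= enorm x.
Proof. exact: sqrtr_ge0. Qed.

Lemma sqr_enorm x : enorm x ^+ 2 = dot x x.
Proof. by rewrite /enorm sqr_sqrtr// dot_ge0. Qed.

Lemma enorm0 : enorm (0 : 'rV[R]_n) = 0.
Proof. by rewrite /enorm /dot big1 ?sqrtr0// => i _; rewrite mxE mul0r. Qed.

Lemma enormZ (c : R) x : enorm (c *: x) = `|c| * enorm x.
Proof.
by rewrite /enorm dotZl dotZr mulrA -expr2 sqrtrM ?sqr_ge0// sqrtr_sqr.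
Qed.

Lemma invr_enorm x : (enorm x)^-1 = dot x x `^ (- 2^-1).
Proof. by rewrite powRN powR12_sqrt// dot_ge0. Qed.

Lemma cauchy_schwarz x y : dot x y <= enorm x * enorm y.
Proof.
have [->|x0] := eqVneq x 0; first by rewrite enorm0 mul0r /dot big1 // => i _; rewrite mxE mul0r.
have [->|y0] := eqVneq y 0; first by rewrite enorm0 mulr0 /dot big1 // => i _; rewrite mxE mulr0.
have nx : 0 < enorm x by rewrite sqrtr_gt0 dot_gt0.
have ny : 0 < enorm y by rewrite sqrtr_gt0 dot_gt0.
have := dot_ge0 (enorm y *: x - enorm x *: y).
rewrite dotDl !dotDr !dotNl !dotNr !dotZl !dotZr -!sqr_enorm (dotC y x).
move: (dot x y) => d H.
have : 0 <= 2 * (enorm x * enorm y) * (enorm x * enorm y - d) by nra.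
by rewrite pmulr_rge0 ?subr_ge0// !mulr_gt0.
Qed.

Lemma coord_le_enorm x i : `|x ord0 i| <= enorm x.
Proof.
rewrite -sqrtr_sqr /enorm ler_wsqrtr// expr2 /dot (bigD1 i)//= lerDl.
by apply: sumr_ge0 => j _; rewrite -expr2 sqr_ge0.
Qed.

Lemma sphere_direction x : 0 < enorm x -> sphere n (direction x).
Proof.
move=> x0; rewrite /sphere /= /direction enormZ ger0_norm ?invr_ge0 ?enorm_ge0//.
by rewrite mulVf// gt_eqF.
Qed.

Lemma sphere_coord_le1 x i : sphere n x -> `|x ord0 i| <= 1.
Proof.
by move=> x1; rewrite -[leRHS]x1; exact: coord_le_enorm.
Qed.

Lemma measurable_sphere : measurable (sphere n : set 'rV[R]_n).
Proof.
rewrite (_ : sphere n = setT `&` enorm @^-1` [set 1]).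
  by apply: measurable_enorm => //; exact: measurable_set1.
by rewrite setTI.
Qed.

End euclidean_vectors.

Lemma dot_e_last {R : realType} n (v : 'rV[R]_n.+1) :
  dot v (e_last n.+1) = v ord0 ord_max.
Proof.
rewrite /dot (bigD1 ord_max)//= mxE eqxx mulr1 big1 ?addr0// => i im.
rewrite mxE (_ : (i.+1 == n.+1) = false) ?mulr0//.
by apply: contraNF im; rewrite eqSS => /eqP im; apply/eqP/val_inj.
Qed.

(** * Smooth functions *)

(** On the ring of scalars, scaling is multiplication; derivatives of products
come with scalings. *)
Lemma scaleRoE {R : realType} (a b : R) : a *: (b : R^o) = a * b.
Proof. by []. Qed.

Section directional_smoothness.
Context {R : realType} {V : normedModType R} {I : Type}.
Variable e : I -> V.
Implicit Types (U : set V) (f g : V -> R).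

(** [k] times continuously differentiable along the directions [e i]. One
family of vectors serves both the line, with the single direction 1, and
['rV[R]_d], with the canonical basis, so that the closure properties below are
proved once. *)
Fixpoint Cdir (k : nat) U f : Prop :=
  (forall x, U x -> {for x, continuous f}) /\
  if k is k'.+1 then
    forall i, (forall x, U x -> derivable f x (e i)) /\
              Cdir k' U (fun x => 'D_(e i) f x)
  else True.

Lemma Cdir_continuous k U f : Cdir k U f ->
  forall x, U x -> {for x, continuous f}.
Proof. by case: k => [|k] []. Qed.

Lemma Cdir_eq k U f g : open U -> (forall x, U x -> f x = g x) ->
  Cdir k U f -> Cdir k U g.
Proof.
move=> oU; elim: k f g => [|k IH] f g fg /= [cf df].
  split=> // x Ux; have n := open_nbhs_nbhs (conj oU Ux).
  rewrite /prop_for /continuous_at -(fg _ Ux).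
  apply: cvg_trans (cf _ Ux); apply: near_eq_cvg.
  by near=> y; rewrite fg//; near: y.
have nearfg x : U x -> \forall y \near x, f y = g y.
  move=> Ux; near=> y; apply: fg; near: y.
  exact: open_nbhs_nbhs.
split.
  move=> x Ux; rewrite /prop_for /continuous_at -(fg _ Ux).
  by apply: cvg_trans (cf _ Ux); apply: near_eq_cvg; exact: nearfg.
move=> i; have [dfi cfi] := df i; split.
  by move=> x Ux; apply: near_eq_derivable (dfi _ Ux); exact: nearfg.
apply: IH cfi => x Ux; apply: near_eq_derive; exact: nearfg.
Unshelve. all: by end_near. Qed.

(** Iterated derivatives may be replaced by any functions that represent them
on [U]. *)
Lemma Cdir_intro k U f (f' : I -> V -> R) : open U ->
  (forall x, U x -> {for x, continuous f}) ->
  (forall i x, U x -> is_derive x (e i) f (f' i x)) ->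
  (forall i, Cdir k U (f' i)) -> Cdir k.+1 U f.
Proof.
move=> oU cf df cf'; split=> // i; split.
  by move=> x Ux; have [] := df i x Ux.
apply: Cdir_eq (cf' i) => // x Ux.
by have [_ ->] := df i x Ux.
Qed.

Lemma Cdir_pred k U f : Cdir k.+1 U f -> Cdir k U f.
Proof.
elim: k f => [|k IH] f /= [cf df]; split=> // i.
have [dfi cfi] := df i; split=> //; exact: IH.
Qed.

Lemma Cdir_is_derive k U f : Cdir k.+1 U f -> forall i x, U x ->
  is_derive x (e i) f ('D_(e i) f x).
Proof. by move=> [_ df] i x Ux; have [/(_ _ Ux)/derivableP]:= df i. Qed.

Lemma Cdir_cst k U (c : R) : open U -> Cdir k U (fun=> c).
Proof.
move=> oU; elim: k c => [|k IH] c.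
  by split=> // x _; exact: cst_continuous.
apply: (@Cdir_intro _ _ _ (fun _ => fun=> 0)) => //.
by move=> x _; exact: cst_continuous.
Qed.

Lemma Cdir_add k U f g : open U -> Cdir k U f -> Cdir k U g ->
  Cdir k U (fun x => f x + g x).
Proof.
move=> oU; elim: k f g => [|k IH] f g cf cg.
  by split=> // x Ux; apply: continuousD; [exact: (Cdir_continuous cf Ux)|exact: (Cdir_continuous cg Ux)].
apply: (@Cdir_intro _ _ _ (fun i x => 'D_(e i) f x + 'D_(e i) g x)) => //.
- by move=> x Ux; apply: continuousD; [exact: (Cdir_continuous cf Ux)|exact: (Cdir_continuous cg Ux)].
- move=> i x Ux; exact: (is_deriveD (Cdir_is_derive cf i Ux) (Cdir_is_derive cg i Ux)).
- by move=> i; apply: IH; [case: (cf.2 i)|case: (cg.2 i)].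
Qed.

Lemma Cdir_mul k U f g : open U -> Cdir k U f -> Cdir k U g ->
  Cdir k U (fun x => f x * g x).
Proof.
move=> oU; elim: k f g => [|k IH] f g cf cg.
  by split=> // x Ux; apply: continuousM; [exact: (Cdir_continuous cf Ux)|exact: (Cdir_continuous cg Ux)].
apply: (@Cdir_intro _ _ _
  (fun i x => f x * 'D_(e i) g x + g x * 'D_(e i) f x)) => //.
- by move=> x Ux; apply: continuousM; [exact: (Cdir_continuous cf Ux)|exact: (Cdir_continuous cg Ux)].
- move=> i x Ux; exact: (is_deriveM (Cdir_is_derive cf i Ux) (Cdir_is_derive cg i Ux)).
- move=> i; apply: Cdir_add => //; apply: IH => //.
  + exact: Cdir_pred.
  + by case: (cg.2 i).
  + exact: Cdir_pred.
  + by case: (cf.2 i).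
Qed.

Lemma Cdir_sum k U n (f : 'I_n -> V -> R) : open U ->
  (forall i, Cdir k U (f i)) -> Cdir k U (fun x => \sum_i f i x).
Proof.
move=> oU; elim: n f => [|n IH] f cf.
  by apply: Cdir_eq (Cdir_cst k 0 oU) => // x _; rewrite big_ord0.
apply: (@Cdir_eq _ _ (fun x => f ord0 x + \sum_(i < n) f (lift ord0 i) x)) => //.
  by move=> x _; rewrite big_ord_recl.
by apply: Cdir_add => //; exact: IH.
Qed.

End directional_smoothness.

Definition C1 {R : realType} (k : nat) (U : set R) (f : R -> R) :=
  Cdir (fun _ : unit => 1 : R^o) k U f.

Lemma C1_intro {R : realType} k (U : set R) (f f' : R -> R) : open U ->
  (forall x, U x -> is_derive x 1 f (f' x)) -> C1 k U f' -> C1 k.+1 U f.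
Proof.
move=> oU df cf'; apply: (@Cdir_intro _ R^o unit _ _ _ _ (fun _ => f')) => //.
move=> x Ux; apply/differentiable_continuous/derivable1_diffP.
by have [] := df x Ux.
Qed.

(** The chain rule along a direction: restrict [q] to the line through [x]. *)
Lemma is_derive_comp_dir {R : realType} {V : normedModType R} (q : V -> R)
    (F : R -> R) (x v : V) (dq dF : R) :
  is_derive x v q dq -> is_derive (q x) 1 F dF ->
  is_derive x v (fun y => F (q y)) (dF * dq).
Proof.
move=> [qx <-] [Fx <-].
have q1 := (derivable1P _ _ _).1 qx.
have q0 : (fun h : R => q (h *: v + x)) 0 = q x by rewrite scale0r add0r.
have Fx' : derivable F ((fun h : R => q (h *: v + x)) 0) 1 by rewrite q0.
have E (W : V -> R) : 'D_v W x = derive1 (fun h : R => W (h *: v + x)) 0.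
  rewrite /derive1 /derive; set g1 := fun h => h^-1 *: _; set g2 := fun h => h^-1 *: _.
  suff -> : g1 = g2 by [].
  by apply/funext => h; rewrite /g1 /g2 /= addr0 scale0r add0r.
split.
  apply/derivable1P.
  apply/derivable1_diffP.
  by apply: (@differentiable_comp _ _ _ _ (fun h : R => q (h *: v + x)) F);
    exact/derivable1_diffP.
by rewrite E (derive1_comp q1 Fx') -E q0 derive1E.
Qed.

Lemma Cdir_comp {R : realType} {V : normedModType R} {I : Type} (e : I -> V)
    k (U : set V) (W : set R) (q : V -> R) (F : R -> R) : open U -> open W ->
  (forall x, U x -> W (q x)) -> C1 k W F -> Cdir e k U q ->
  Cdir e k U (fun x => F (q x)).
Proof.
move=> oU oW UW; elim: k F => [|k IH] F cF cq.
  split=> // x Ux; apply: continuous_comp; first exact: (Cdir_continuous cq Ux).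
  exact: (Cdir_continuous cF (UW _ Ux)).
apply: (@Cdir_intro _ _ _ _ _ _ _
  (fun i x => 'D_1 F (q x) * 'D_(e i) q x)) => //.
- move=> x Ux; apply: continuous_comp; first exact: (Cdir_continuous cq Ux).
  exact: (Cdir_continuous cF (UW _ Ux)).
- move=> i x Ux; apply: is_derive_comp_dir; first exact: (Cdir_is_derive cq i Ux).
  exact: (Cdir_is_derive cF tt (UW _ Ux)).
- move=> i; apply: Cdir_mul => //; last by case: (cq.2 i).
  apply: (IH (fun z => 'D_1 F z)); last exact: Cdir_pred.
  by case: (cF.2 tt).
Qed.

Lemma C1_comp {R : realType} k (U W : set R) (q F : R -> R) :
  open U -> open W -> (forall x, U x -> W (q x)) ->
  C1 k W F -> C1 k U q -> C1 k U (fun x => F (q x)).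
Proof. exact: Cdir_comp. Qed.

Lemma C1_id {R : realType} k (U : set R) : open U -> C1 k U id.
Proof.
move=> oU; case: k => [|k]; first by split=> // x _; exact: cvg_id.
by apply: (@C1_intro _ _ _ _ (fun=> 1)) => //; exact: Cdir_cst.
Qed.

Lemma open_gt0 {R : realType} : open [set x : R | 0 < x].
Proof. exact: open_gt. Qed.

Lemma C1_powR {R : realType} k (a : R) : C1 k [set x | 0 < x] (fun x => x `^ a).
Proof.
elim: k a => [|k IH] a.
  split=> // x x0; apply/differentiable_continuous/derivable1_diffP.
  by have [] := is_derive1_powR a x0.
apply: (@C1_intro _ _ _ _ (fun x => a * x `^ (a - 1))).
- exact: open_gt0.
- exact: (Cdir_mul open_gt0 (Cdir_cst _ k a open_gt0) (IH (a - 1))).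
Qed.

Section smooth_line.
Context {R : realType}.
Local Notation leb := (@lebesgue_measure R).
Implicit Types (f F : R -> R) (a b t : R).

Lemma C1_subset k (U V : set R) (f : R -> R) :
  V `<=` U -> C1 k U f -> C1 k V f.
Proof.
move=> VU; elim: k f => [|k IH] f [cU dU]; split=> //.
- by move=> x /VU; exact: cU.
- by move=> x /VU; exact: cU.
- move=> i; have [dUi CU] := dU i; split; last exact: IH.
  by move=> x /VU; exact: dUi.
Qed.

Lemma C1_union k (U V : set R) (f : R -> R) : C1 k U f -> C1 k V f -> C1 k (U `|` V) f.
Proof.
elim: k f => [|k IH] f [cU dU] [cV dV]; split=> //.
- by move=> x [/cU|/cV].
- by move=> x [/cU|/cV].
- move=> i; have [dUi CU] := dU i; have [dVi CV] := dV i; split.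
    by move=> x [/dUi|/dVi].
  exact: IH.
Qed.

Lemma C1_continuous (f : R -> R) : C1 0 [set: R] f -> continuous f.
Proof. by move=> [cf _] x; exact: cf. Qed.

Lemma is_derive_unique (f : R -> R) (t d d' : R) :
  is_derive t 1 f d -> is_derive t 1 f d' -> d = d'.
Proof. by move=> [_ <-] [_ <-]. Qed.

Lemma near_notin_segment (a b t : R) : ~~ (a <= t <= b) ->
  \forall x \near t, ~~ (a <= x <= b).
Proof.
rewrite negb_and -!ltNge => /orP[ta|bt].
  by apply: filterS (lt_nbhsl ta) => x xa; rewrite negb_and -!ltNge xa.
by apply: filterS (lt_nbhsr bt) => x xb; rewrite negb_and -!ltNge xb orbT.
Qed.

Lemma open_notin_segment (a b : R) : open [set t : R | ~~ (a <= t <= b)].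
Proof.
rewrite openE => t /= tab; exact: near_notin_segment.
Qed.

Lemma is_derive_outside (f f' : R -> R) (a b : R) :
  (forall t : R, is_derive t 1 f (f' t)) -> (forall t, ~~ (a <= t <= b) -> f t = 0) ->
  forall t, ~~ (a <= t <= b) -> f' t = 0.
Proof.
move=> df f0 t tab; apply: is_derive_unique (df t) _.
apply: (@near_eq_is_derive _ _ _ (cst 0)) => //.
near=> y; rewrite f0//; near: y; exact: near_notin_segment.
Unshelve. all: by end_near. Qed.

Lemma is_derive_continuous (F f : R -> R) :
  (forall t : R, is_derive t 1 F (f t)) -> continuous F.
Proof.
move=> dF t; apply/differentiable_continuous/derivable1_diffP.
by have [] := dF t.
Qed.

Lemma C1_derive (f : R -> R) : (forall k, C1 k [set: R] f) ->
  exists2 f' : R -> R, (forall t : R, is_derive t 1 f (f' t)) &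
    forall k, C1 k [set: R] f'.
Proof.
move=> cf; exists (fun t => 'D_1 f t) => [t|k].
  have [_ /(_ tt)[df _]] := cf 1%N; exact: (derivableP (df t I)).
by have [_ /(_ tt) []] := cf k.+1.
Qed.

Lemma C1_primitive k (F f : R -> R) :
  (forall x : R, is_derive x 1 F (f x)) -> C1 k [set: R] f -> C1 k.+1 [set: R] F.
Proof. by move=> dF cf; apply: C1_intro cf => //; exact: openT. Qed.

Lemma C1_of_derive (F f : R -> R) : (forall t : R, is_derive t 1 F (f t)) ->
  (forall j, C1 j [set: R] f) -> forall j, C1 j [set: R] F.
Proof.
move=> dF cf [|j]; last exact: C1_primitive dF (cf j).
by split=> // t _; exact: is_derive_continuous dF t.
Qed.

Lemma is_derive_subZ (F f H e : R -> R) (c : R) :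
  (forall t : R, is_derive t 1 F (f t)) -> (forall t : R, is_derive t 1 H (e t)) ->
  forall t : R, is_derive t 1 (fun t => F t - c * H t) (f t - c * e t).
Proof.
move=> dF dH t.
apply: (is_derive_eq (is_deriveB (dF t) (is_deriveM (@is_derive_cst R R^o R^o c t 1) (dH t)))).
by rewrite !scaleRoE mulr0 addr0.
Qed.

Lemma C1_subZ (F H : R -> R) (c : R) j : C1 j [set: R] F -> C1 j [set: R] H ->
  C1 j [set: R] (fun t => F t - c * H t).
Proof.
move=> cF cH; rewrite (_ : (fun t => _) = fun t => F t + (- c) * H t); last first.
  by apply/funext => t; rewrite mulNr.
apply: Cdir_add; [exact: openT|exact: cF|].
by apply: Cdir_mul; [exact: openT|exact: Cdir_cst openT|exact: cH].
Qed.

Lemma mean_value (F f : R -> R) (x y : R) :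
  (forall t : R, is_derive t 1 F (f t)) -> x <= y ->
  exists2 c, x <= c <= y & F y - F x = f c * (y - x).
Proof.
move=> dF xy.
have cF : {within `[x, y], continuous F}.
  by apply: continuous_subspaceT; exact: is_derive_continuous dF.
have [c] := @MVT_segment R F f x y xy (fun z _ => dF z) cF.
by rewrite in_itv/= => cxy E; exists c.
Qed.

Lemma primitive_homo (F f : R -> R) : (forall t : R, is_derive t 1 F (f t)) ->
  (forall t, 0 <= f t) -> {homo F : x y / x <= y}.
Proof.
move=> dF f0 x y xy; have [c _ E] := mean_value dF xy.
by rewrite -subr_ge0 E mulr_ge0// subr_ge0.
Qed.

Lemma primitive_const (F f : R -> R) (b : R) : (forall t : R, is_derive t 1 F (f t)) ->
  (forall t, b <= t -> f t = 0) -> forall t, b <= t -> F t = F b.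
Proof.
move=> dF f0 t bt; have [c /andP[bc _] E] := mean_value dF bt.
by apply/eqP; rewrite -subr_eq0 E f0// mul0r.
Qed.

Lemma primitive_gt0 (F f : R -> R) (a b : R) : (forall t : R, is_derive t 1 F (f t)) ->
  (forall t, 0 <= f t) -> (forall t, a < t < b -> 0 < f t) -> a < b -> F a < F b.
Proof.
move=> dF f0 fpos ab.
have ab1 : a < (2 * a + b) / 3 by lra.
have ab2 : (2 * a + b) / 3 < (a + 2 * b) / 3 by lra.
have ab3 : (a + 2 * b) / 3 < b by lra.
have [c /andP[c1 c2] E] := mean_value dF (ltW ab2).
have h1 := primitive_homo dF f0 (ltW ab1); have h3 := primitive_homo dF f0 (ltW ab3).
have : 0 < f c * ((a + 2 * b) / 3 - (2 * a + b) / 3).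
  by rewrite mulr_gt0// ?subr_gt0// fpos//; apply/andP; split; lra.
by rewrite -E; lra.
Qed.

Lemma continuous_within (f : R -> R) (a b : R) :
  (forall x, a <= x <= b -> {for x, continuous f}) ->
  {within `[a, b], continuous f}.
Proof.
move=> cf; apply: continuous_in_subspaceT => x; rewrite inE/= in_itv/=.
exact: cf.
Qed.

Lemma segment_integrable (a b : R) (f : R -> R) :
  (forall t, a <= t <= b -> {for t, continuous f}) ->
  leb.-integrable `[a, b] (EFin \o f).
Proof.
move=> cf; apply: continuous_compact_integrable; first exact: segment_compact.
exact: continuous_within.
Qed.

(** Vanishing on the left of [a] makes the integral from [a - 1] differentiable
on the whole line, including at the points where it is constant. *)
Lemma primitive_exists (f : R -> R) (a : R) :
  continuous f -> (forall x, x <= a -> f x = 0) ->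
  exists2 F : R -> R, (forall x, x <= a -> F x = 0) &
    forall x : R, is_derive x 1 F (f x).
Proof.
move=> cf f0.
pose F (x : R) : R := \int[lebesgue_measure]_(t in `[a - 1, x]) f t.
have F0 x : x <= a -> F x = 0.
  move=> xa; rewrite /F (_ : \int[_]_(t in _) _ =
    \int[lebesgue_measure]_(t in `[a - 1, x]) (cst 0 t)).
    by rewrite Rintegral_cst// mul0r.
  apply: eq_Rintegral => t; rewrite inE/= in_itv/= => /andP[_ tx].
  by rewrite f0// (le_trans tx).
exists F => // x.
have [xa|ax] := ltP x a.
  rewrite (f0 _ (ltW xa)); apply: (@near_eq_is_derive _ _ _ (cst 0)) => //.
  near=> y; rewrite F0//; near: y.
  by apply: filterS (lt_nbhsl xa) => y /ltW.
have ax' : a - 1 < x by rewrite (lt_le_trans _ ax)// gtrBl.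
have xx1 : x < x + 1 by rewrite ltrDl.
have intf : lebesgue_measure.-integrable `[a - 1, x + 1] (EFin \o f).
  apply: continuous_compact_integrable; first exact: segment_compact.
  exact: continuous_subspaceT.
have [dF F'] := @continuous_FTC1_closed R f (a - 1) x (x + 1) xx1 intf ax' (cf x).
by apply: DeriveDef; [exact: dF|rewrite -derive1E; exact: F'].
Unshelve. all: by end_near. Qed.

End smooth_line.

(** * Bumps and mollifiers *)

Section mollifiers.
Context {R : realType}.
Local Notation leb := (@lebesgue_measure R).

(** The functions [x^-j exp(-1/x)], extended by 0 to the left: their linear span
is closed under differentiation, whence the smoothness of each of them. *)
Definition flat (j : nat) (x : R) : R :=
  if 0 < x then x^-1 ^+ j * expR (- x^-1) else 0.

Lemma flat_ge0 j x : 0 <= flat j x.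
Proof.
rewrite /flat; case: ifP => // x0.
by rewrite mulr_ge0 ?expR_ge0// exprn_ge0// invr_ge0 ltW.
Qed.

Lemma flat_le0 j x : x <= 0 -> flat j x = 0.
Proof. by rewrite /flat ltNge => ->. Qed.

Lemma flat_gt0 x : 0 < x -> 0 < flat 0 x.
Proof. by rewrite /flat => ->; rewrite expr0 mul1r expR_gt0. Qed.

(** Gives the limits at 0. The bound is [1 + y <= exp y] at [y = 1 / (x (j + 1))],
raised to the power [j + 1]. *)
Lemma flat_le j x : flat j x <= (j.+1%:R ^+ j.+1) * `|x|.
Proof.
rewrite /flat; case: ifPn => x0; last by rewrite mulr_ge0// exprn_ge0.
rewrite gtr0_norm// expRN ler_pdivrMr ?expR_gt0//.
have y0 : 0 < x^-1 by rewrite invr_gt0.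
have -> : expR x^-1 = expR (x^-1 / j.+1%:R) ^+ j.+1.
  by rewrite -expRM_natl mulrC divfK.
have : (x^-1 / j.+1%:R) ^+ j.+1 <= expR (x^-1 / j.+1%:R) ^+ j.+1.
  rewrite lerXn2r ?nnegrE ?expR_ge0 ?divr_ge0// ?(ltW y0)//.
  by apply: le_trans (expR_ge1Dx _); rewrite lerDr.
rewrite expr_div_n => H.
have C0 : 0 < j.+1%:R ^+ j.+1 :> R by rewrite exprn_gt0.
apply: le_trans (ler_wpM2l _ H); last by rewrite mulr_ge0 ?ltW.
rewrite [x^-1 ^+ j.+1]exprS le_eqVlt; apply/orP; left; apply/eqP.
move: (j.+1%:R ^+ _) C0 (x^-1 ^+ j) => C C0 Y; field.
by rewrite !gt_eqF.
Qed.

Lemma is_derive_flat j (x : R) :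
  is_derive x 1 (flat j) (flat j.+2 x - j%:R * flat j.+1 x).
Proof.
have [x0|x0|->] := ltgtP x 0.
- rewrite !flat_le0 ?ltW// mulr0 subr0.
  apply: (@near_eq_is_derive _ _ _ (cst 0)) => //.
  near=> y; rewrite flat_le0//; near: y.
  by apply: filterS (lt_nbhsl x0) => y /ltW.
- apply: (@near_eq_is_derive _ _ _
    ((fun x => x^-1) ^+ j * (fun x => expR (- x^-1)))).
    near=> y; rewrite /flat ifT ?exprfctE//; near: y.
    exact: lt_nbhsr.
  have xn0 : x != 0 by rewrite gt_eqF.
  have dV : is_derive x 1 (fun y : R => y^-1) (- x^-2).
    split; first exact: derivableV.
    have := @deriveV _ _ (@id R) x 1 xn0 (@derivable_id _ _ _ _).
    by rewrite derive_id => ->; exact: mulr1.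
  have dE : is_derive x 1 (fun y : R => expR (- y^-1)) (expR (- x^-1) * (x^-2)).
    rewrite -[x^-2]opprK; apply: is_derive_comp_dir.
  apply: (is_derive_eq (is_deriveM (is_deriveX j dV) dE)).
  rewrite /flat x0 /= !exprfctE.
  rewrite !scaleRoE -exprVn; rewrite /=; set y := x^-1; set E := expR _.
  by case: j => [|j]; rewrite /= ?exprS; ring.
- rewrite !flat_le0// mulr0 subr0.
  suff H : (fun h : R => h^-1 *: ((flat j \o shift 0) (h *: 1) - flat j 0)) @ 0^'
      --> (0 : R).
    by apply: DeriveDef; [apply/cvg_ex; exists 0|exact: cvg_lim H].
  apply/cvgr0Pnorm_lt => eps eps0.
  pose C : R := j.+2%:R ^+ j.+2.
  have C0 : 0 < C by rewrite exprn_gt0.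
  near=> h.
  have -> : h^-1 *: ((flat j \o shift 0) (h *: 1) - flat j 0) = flat j.+1 h.
    rewrite /= addr0 [h *: _]mulr1 [flat j 0]flat_le0// subr0.
    rewrite /flat; case: ifPn => h0; last by rewrite scaler0.
    by rewrite exprS -mulrA.
  rewrite ger0_norm ?flat_ge0//; apply: le_lt_trans (flat_le _ _) _.
  rewrite -/C mulrC -ltr_pdivlMr//; near: h.
  by apply: dnbhs0_lt; rewrite divr_gt0.
Unshelve. all: by end_near. Qed.

Lemma C1_flat k j : C1 k [set: R] (flat j).
Proof.
elim: k j => [|k IH] j.
  split=> // x _; apply/differentiable_continuous/derivable1_diffP.
  by have [] := is_derive_flat j x.
apply: (@C1_intro _ _ _ _ (fun x => flat j.+2 x - j%:R * flat j.+1 x)).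
- exact: openT.
- by move=> x _; exact: is_derive_flat.
- have -> : (fun x => flat j.+2 x - j%:R * flat j.+1 x) =
      (fun x => flat j.+2 x + (- j%:R) * flat j.+1 x).
    by apply/funext => x; rewrite mulNr.
  apply: Cdir_add; [exact: openT|exact: IH|].
  by apply: Cdir_mul; [exact: openT|apply: Cdir_cst; exact: openT|exact: IH].
Qed.

Definition sbump (a b x : R) : R := flat 0 (x - a) * flat 0 (b - x).

Lemma sbump_ge0 a b x : 0 <= sbump a b x.
Proof. by rewrite mulr_ge0// flat_ge0. Qed.

Lemma sbump_gt0 a b x : a < x < b -> 0 < sbump a b x.
Proof. by case/andP => ax xb; rewrite mulr_gt0// flat_gt0 ?subr_gt0. Qed.

Lemma sbump_outl a b x : x <= a -> sbump a b x = 0.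
Proof. by move=> xa; rewrite /sbump flat_le0 ?mul0r// subr_le0. Qed.

Lemma sbump_outr a b x : b <= x -> sbump a b x = 0.
Proof. by move=> xa; rewrite /sbump [X in _ * X]flat_le0 ?mulr0// subr_le0. Qed.

Lemma C1_sbump k a b : C1 k [set: R] (sbump a b).
Proof.
apply: Cdir_mul; first exact: openT.
- apply: (@C1_comp _ _ _ _ (fun x => x - a)) (C1_flat k 0) _ => //;
    do ?exact: openT.
  apply: Cdir_add; [exact: openT|exact: C1_id openT|exact: Cdir_cst openT].
- apply: (@C1_comp _ _ _ _ (fun x => b - x)) (C1_flat k 0) _ => //;
    do ?exact: openT.
  have -> : (fun x => b - x) = (fun x => b + (-1) * x).
    by apply/funext => x; rewrite mulN1r.
  apply: Cdir_add; [exact: openT|exact: Cdir_cst openT|].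
  by apply: Cdir_mul; [exact: openT|exact: Cdir_cst openT|exact: C1_id openT].
Qed.

(** [psi] approximates the Dirac mass at a point of the segment [[c, d]] and its
primitive [F] the corresponding unit step. *)
Definition mollifier (c d : R) (psi F : R -> R) : Prop :=
  [/\ forall k, C1 k [set: R] psi, forall t, 0 <= psi t,
      forall t, ~~ (c <= t <= d) -> psi t = 0,
      forall t : R, is_derive t 1 F (psi t) &
      [/\ forall t, t <= c -> F t = 0, forall t, d <= t -> F t = 1
        & forall t, 0 <= F t <= 1]].

Lemma mollifier_exists (c d : R) : c < d -> exists psi F, mollifier c d psi F.
Proof.
move=> cd; pose f := sbump c d : R -> R.
have cf : continuous f by apply: C1_continuous; exact: C1_sbump.
have f0 t : 0 <= f t by exact: sbump_ge0.
have [F F0 dF] := primitive_exists cf (@sbump_outl c d).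
have Fd : 0 < F d.
  rewrite -(F0 c (lexx _)); apply: (primitive_gt0 dF) => //.
  by move=> t; exact: sbump_gt0.
have Fge t : d <= t -> F t = F d.
  by apply: (primitive_const dF) => u; exact: sbump_outr.
have dG (t : R) : is_derive t 1 (fun t => (F d)^-1 * F t) ((F d)^-1 * f t).
  apply: (is_derive_eq (is_deriveM (@is_derive_cst R R^o R^o (F d)^-1 t 1) (dF t))).
  by rewrite !scaleRoE mulr0 addr0.
have g0 t : 0 <= (F d)^-1 * f t by rewrite mulr_ge0// invr_ge0 ltW.
have G0 t : t <= c -> (F d)^-1 * F t = 0 by move=> /F0 ->; rewrite mulr0.
have G1 t : d <= t -> (F d)^-1 * F t = 1.
  by move=> /Fge ->; rewrite mulVf// gt_eqF.
exists (fun t => (F d)^-1 * f t), (fun t => (F d)^-1 * F t); split=> //.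
- by move=> k; apply: Cdir_mul; [exact: openT|exact: Cdir_cst openT|exact: C1_sbump].
- move=> t; rewrite negb_and -!ltNge => /orP[/ltW tc|/ltW dt].
    by rewrite /f sbump_outl// mulr0.
  by rewrite /f sbump_outr// mulr0.
split=> // t; apply/andP; split.
  have [tc|ct] := leP t c; first by rewrite G0.
  by rewrite -(G0 c (lexx _)); exact: (primitive_homo dG g0 (ltW ct)).
have [dt|td] := leP d t; first by rewrite G1.
by rewrite -(G1 d (lexx _)); exact: (primitive_homo dG g0 (ltW td)).
Qed.

Lemma mollifier_average (a b c d eta y : R) (f psi F : R -> R) :
  a < b -> a <= c -> d <= b -> mollifier c d psi F ->
  (forall t, a <= t <= b -> {for t, continuous f}) ->
  (forall t, c <= t <= d -> `|f t - y| <= eta) ->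
  `|\int[leb]_(t in `[a, b]) (f t * psi t) - y| <= eta.
Proof.
move=> ab ac db [Cpsi psi0 psiout dF [Fl Fr _]] cf fy.
have cpsi : continuous psi by exact: C1_continuous (Cpsi 0%N).
have Fa : F a = 0 by exact: Fl.
have Fb : F b = 1 by exact: Fr.
have mI : measurable (`[a, b]%classic : set (measurableTypeR R)) by exact: measurable_itv.
have i1 : leb.-integrable `[a, b] (EFin \o psi).
  by apply: segment_integrable => t _; exact: cpsi.
have I1 : \int[leb]_(t in `[a, b]) psi t = 1.
  rewrite /Rintegral (@continuous_FTC2 R psi F a b ab).
  - by rewrite Fa Fb sube0.
  - exact: continuous_subspaceT.
  - split.
    + by move=> x _; have [] := dF x.
    + by apply: cvg_at_right_filter; exact: is_derive_continuous dF _.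
    + by apply: cvg_at_left_filter; exact: is_derive_continuous dF _.
  - by move=> x _; rewrite derive1E; have [_ ->] := dF x.
have i2 : leb.-integrable `[a, b] (EFin \o (fun t => f t * psi t)).
  by apply: segment_integrable => t /cf tab; apply: continuousM; [exact: tab|exact: cpsi].
have i3 (z : R) : leb.-integrable `[a, b] (EFin \o (fun t => z * psi t)).
  by have := @integrableZl _ _ _ leb _ mI z (EFin \o psi) i1.
have i4 : leb.-integrable `[a, b] (EFin \o (fun t => f t * psi t - y * psi t)).
  by have := integrableB mI i2 (i3 y).
have -> : \int[leb]_(t in `[a, b]) (f t * psi t) - y =
    \int[leb]_(t in `[a, b]) (f t * psi t - y * psi t).
  by rewrite RintegralB// RintegralZl// I1 mulr1.
apply: le_trans (le_normr_Rintegral mI i4) _.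
rewrite -[leRHS]mulr1 -I1 -RintegralZl//; apply: le_Rintegral => //.
  by have := integrable_norm i4.
move=> t _; rewrite -mulrBl normrM (ger0_norm (psi0 t)).
have [tcd|tcd] := boolP (c <= t <= d); first by rewrite ler_wpM2r// fy.
by rewrite psiout// !mulr0.
Qed.

End mollifiers.

(** * The Laplacian of a zonal function *)

Section zonal.
Context {R : realType} {m : nat}.
Local Notation E := 'rV[R]_m.+1.
Implicit Types (x v : E) (f : R -> R).

Lemma is_derive_coord x (i j : 'I_m.+1) :
  is_derive x 'e_i (fun y : E => y ord0 j) (i == j)%:R.
Proof.
suff H : (fun h : R => h^-1 *: (((fun y : E => y ord0 j) \o shift x) (h *: 'e_i)
    - x ord0 j)) @ 0^' --> ((i == j)%:R : R).
  by apply: DeriveDef; [apply/cvg_ex; exists (i == j)%:R|exact: cvg_lim H].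
apply: (@cvg_trans _ ((fun=> (i == j)%:R : R) @ (0 : R)^')); last exact: cvg_cst.
apply: near_eq_cvg; near=> h.
have h0 : h != 0 by near: h; exact: nbhs_dnbhs_neq.
rewrite /= !mxE eqxx /= addrK [j == i]eq_sym.
by rewrite [_ *: _]mulrA mulVf// mul1r.
Unshelve. all: by end_near. Qed.

Lemma open_neq0 : open [set x : E | x != 0].
Proof.
rewrite (_ : mkset _ = ~` [set 0]); last by apply/seteqP; split=> x /= /eqP.
rewrite openC; apply: accessible_closed_set1; apply: hausdorff_accessible.
exact: norm_hausdorff.
Qed.

Lemma Cdir_coord k (U : set E) j : open U ->
  Cdir (fun i : 'I_m.+1 => 'e_i) k U (fun x : E => x ord0 j).
Proof.
move=> oU; case: k => [|k]; first by split=> // x _; exact: coord_continuous.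
apply: (@Cdir_intro _ _ _ _ _ _ _ (fun i => fun=> (i == j)%:R)) => //.
- by move=> x _; exact: coord_continuous.
- by move=> i x _; exact: is_derive_coord.
- by move=> i; exact: Cdir_cst.
Qed.

Lemma Cdir_dot k (U : set E) : open U ->
  Cdir (fun i : 'I_m.+1 => 'e_i) k U (fun x : E => dot x x).
Proof.
by move=> oU; apply: Cdir_sum => // i; apply: Cdir_mul => //; exact: Cdir_coord.
Qed.

Lemma is_derive_dot x (i : 'I_m.+1) :
  is_derive x 'e_i (fun y : E => dot y y) (2 * x ord0 i).
Proof.
have D j := is_deriveM (is_derive_coord x i j) (is_derive_coord x i j).
have := is_derive_sum D.
have -> : (\sum_(j < m.+1) ((fun y : E => y ord0 j) * (fun y : E => y ord0 j)))
    = (fun y : E => dot y y).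
  by apply/funext => y; rewrite /dot fct_sumE.
move=> H; apply: (is_derive_eq H).
rewrite (bigD1 i)//= big1 => [|j ji]; last first.
  by rewrite eq_sym (negPf ji) scaler0 addr0.
by rewrite eqxx addr0 [_ *: _]mulr1; ring.
Qed.

Lemma Cdir_invr_enorm k :
  Cdir (fun i : 'I_m.+1 => 'e_i) k [set x | x != 0] (fun x : E => (enorm x)^-1).
Proof.
rewrite (_ : (fun _ => _) = fun x => dot x x `^ (- 2^-1)); last first.
  by apply/funext => x; rewrite invr_enorm.
apply: (Cdir_comp open_neq0 open_gt0 _ (C1_powR k _)); first exact: dot_gt0.
by apply: Cdir_dot; exact: open_neq0.
Qed.

Lemma is_derive_invr_enorm x (i : 'I_m.+1) : x != 0 ->
  is_derive x 'e_i (fun y : E => (enorm y)^-1)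
    (- x ord0 i * (enorm x)^-1 ^+ 3).
Proof.
move=> x0; rewrite (_ : (fun _ => _) = fun x => dot x x `^ (- 2^-1)); last first.
  by apply/funext => y; rewrite invr_enorm.
apply: (is_derive_eq (is_derive_comp_dir (is_derive_dot x i)
  (is_derive1_powR _ (dot_gt0 x0)))).
rewrite invr_enorm -powR_mulrn ?powR_ge0// -powRrM.
have -> : - 2^-1 * 3%:R = - 2^-1 - 1 :> R by lra.
by field.
Qed.

(** The height of the direction of [x] along the first axis; the pole of the
zonal functions below is the first basis vector, because the Lebesgue measure
splits off the first coordinate. *)
Definition polar x : R := (enorm x)^-1 * x ord0 ord0.

Definition dpolar (i : 'I_m.+1) x : R :=
  (enorm x)^-1 * (i == ord0)%:R
  - x ord0 ord0 * x ord0 i * (enorm x)^-1 ^+ 3.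

Lemma Cdir_polar k : Cdir (fun i : 'I_m.+1 => 'e_i) k [set x | x != 0] polar.
Proof.
apply: Cdir_mul; [exact: open_neq0|exact: Cdir_invr_enorm|].
exact: Cdir_coord open_neq0.
Qed.

Lemma is_derive_polar x i : x != 0 -> is_derive x 'e_i polar (dpolar i x).
Proof.
move=> x0.
apply: (is_derive_eq (is_deriveM (is_derive_invr_enorm i x0)
  (is_derive_coord x i ord0))).
by rewrite !scaleRoE /dpolar; ring.
Qed.

Lemma is_derive_dpolar x i : x != 0 -> is_derive x 'e_i (dpolar i)
  (- (i == ord0)%:R * x ord0 i * (enorm x)^-1 ^+ 3
   - ((i == ord0)%:R * x ord0 i + x ord0 ord0) * (enorm x)^-1 ^+ 3
   + 3 * x ord0 ord0 * x ord0 i ^+ 2 * (enorm x)^-1 ^+ 5).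
Proof.
move=> x0; have dr := is_derive_invr_enorm i x0.
have d0 := is_derive_coord x i ord0; have di := is_derive_coord x i i.
have dc := @is_derive_cst R E R^o (i == ord0)%:R x 'e_i.
apply: (is_derive_eq (is_deriveB (is_deriveM dr dc)
  (is_deriveM (is_deriveM d0 di) (is_deriveX 3 dr)))).
rewrite !scaleRoE eqxx exprfctE !fctE /=; ring.
Qed.

Definition zonal f : E -> R := fun v => f (v ord0 ord0).

Lemma radial_ext_zonal f : radial_ext (zonal f) = fun x => f (polar x).
Proof. by apply/funext => x; rewrite /radial_ext /zonal /direction !mxE. Qed.

Lemma Ck_of_Cdir k (U : set E) (F : E -> R) :
  Cdir (fun i : 'I_m.+1 => 'e_i) k U F -> Ck k U F.
Proof.
elim: k F => [|k IH] F [cF dF]; first by split.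
by split=> // i; have [dFi cFi] := dF i; split=> //; exact: IH.
Qed.

Lemma smooth_zonal f : (forall k, C1 k [set: R] f) -> smooth_sphere (zonal f).
Proof.
move=> cf k; apply: Ck_of_Cdir; rewrite radial_ext_zonal.
by apply: (Cdir_comp open_neq0 openT _ (cf k)) => //; exact: Cdir_polar.
Qed.

(** With [t = v_0], the gradient of [polar] at a unit vector [v] has squared
norm [1 - t^2] and its divergence is [- m t]. *)
Lemma sphere_laplacian_zonal f f1 f2 v :
  (forall t : R, is_derive t 1 f (f1 t)) ->
  (forall t : R, is_derive t 1 f1 (f2 t)) -> sphere m.+1 v ->
  sphere_laplacian (zonal f) v =
    (1 - v ord0 ord0 ^+ 2) * f2 (v ord0 ord0)
    - m%:R * v ord0 ord0 * f1 (v ord0 ord0).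
Proof.
move=> df df1 v1; rewrite /sphere_laplacian radial_ext_zonal.
have dv1 : dot v v = 1.
  by have := congr1 (fun t => t ^+ 2) v1; rewrite /enorm sqr_sqrtr ?dot_ge0// expr1n.
have v0 : v != 0.
  apply/eqP => v0; move: dv1; rewrite v0 /dot big1 => [/esym/eqP|i _].
    by rewrite oner_eq0.
  by rewrite mxE mul0r.
have D1 i x : x != 0 ->
    'D_('e_i) (fun x : E => f (polar x)) x = f1 (polar x) * dpolar i x.
  move=> x0; have [_ ->//] := is_derive_comp_dir (is_derive_polar i x0) (df (polar x)).
have D2 i : 'D_('e_i) (fun x => 'D_('e_i) (fun x : E => f (polar x)) x) v =
    f1 (polar v) * (- (i == ord0)%:R * v ord0 i - ((i == ord0)%:R * v ord0 i
    + v ord0 ord0) + 3 * v ord0 ord0 * v ord0 i ^+ 2)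
    + f2 (polar v) * ((i == ord0)%:R - v ord0 ord0 * v ord0 i) ^+ 2.
  transitivity ('D_('e_i) (fun x => f1 (polar x) * dpolar i x) v).
    apply: near_eq_derive; near=> x; apply: D1; near: x.
    by apply: open_nbhs_nbhs; split; [exact: open_neq0|].
  have [_ ->] := is_deriveM (is_derive_comp_dir (is_derive_polar i v0) (df1 (polar v)))
    (is_derive_dpolar i v0).
  by rewrite !scaleRoE /dpolar v1 invr1 !expr1n !mulr1 mul1r; ring.
rewrite (eq_bigr _ (fun i _ => D2 i)) /polar v1 invr1 mul1r.
set t := v ord0 ord0; rewrite big_split/= -!mulr_sumr.
have S1 : \sum_(i < m.+1) (i == ord0)%:R * v ord0 i = t.
  rewrite (bigD1 ord0)//= mul1r big1 ?addr0// => i i0.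
  by rewrite (negPf i0) mul0r.
have S2 : \sum_(i < m.+1) v ord0 i ^+ 2 = 1.
  by rewrite -dv1; apply: eq_bigr => i _; rewrite expr2.
have S3 : \sum_(i < m.+1) (i == ord0)%:R ^+ 2 = 1 :> R.
  rewrite (bigD1 ord0)//= expr1n big1 ?addr0// => i i0.
  by rewrite (negPf i0) expr0n.
have -> : \sum_(i < m.+1) (- (i == ord0)%:R * v ord0 i - ((i == ord0)%:R * v ord0 i
    + t) + 3 * t * v ord0 i ^+ 2) = - m%:R * t.
  rewrite (eq_bigr (fun i => - 2 * ((i == ord0)%:R * v ord0 i) - t
    + 3 * t * v ord0 i ^+ 2)); last by move=> i _; ring.
  rewrite !big_split/= -!mulr_sumr S1 S2 sumr_const card_ord -mulr_natr -natr1.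
  by ring.
have -> : \sum_(i < m.+1) ((i == ord0)%:R - t * v ord0 i) ^+ 2 = 1 - t ^+ 2.
  rewrite (eq_bigr (fun i => (i == ord0)%:R ^+ 2
    + (- 2 * t) * ((i == ord0)%:R * v ord0 i)
    + t ^+ 2 * v ord0 i ^+ 2)); last by move=> i _; ring.
  by rewrite !big_split/= -!mulr_sumr S1 S2 S3; ring.
by ring.
Unshelve. all: by end_near. Qed.

End zonal.

(** * Lebesgue measure on row vectors *)

Section lebesgue_rV_theory.
Context {R : realType}.
Local Notation leb := (@lebesgue_measure R).

Definition vcons (m : nat) (p : measurableTypeR R * 'rV[R]_m) : 'rV[R]_m.+1 :=
  row_mx p.1%:M p.2 : 'rV[R]_(1 + m).

Lemma vcons0 m p : (vcons p : 'rV[R]_m.+1) ord0 ord0 = p.1.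
Proof.
rewrite /vcons; have -> : ord0 = lshift m ord0 :> 'I_(1 + m) by exact: val_inj.
by apply: etrans (row_mxEl _ _ _ _) _; rewrite mxE eqxx.
Qed.

Lemma vconsS m p (j : 'I_m) : (vcons p : 'rV[R]_m.+1) ord0 (lift ord0 j) = p.2 ord0 j.
Proof.
rewrite /vcons; have -> : lift ord0 j = rshift 1 j :> 'I_(1 + m) by exact: val_inj.
exact: row_mxEr.
Qed.

Lemma measurable_vcons m : measurable_fun setT (@vcons m).
Proof.
apply: measurable_fun_rV => i; have [->|[j ->]] : i = ord0 \/ exists j, i = lift ord0 j.
  by case: (unliftP ord0 i) => [j ->|->]; [right; exists j|left].
- by under eq_fun do rewrite vcons0; exact: measurable_fst.
- under eq_fun do rewrite vconsS.
  exact: (measurableT_comp (measurable_coord j) measurable_snd).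
Qed.

Lemma dot_vcons m (p q : measurableTypeR R * 'rV[R]_m) :
  dot (vcons p) (vcons q) = p.1 * q.1 + dot p.2 q.2.
Proof.
rewrite /dot big_ord_recl !vcons0; congr (_ + _).
by apply: eq_bigr => i _; rewrite !vconsS.
Qed.

Local Open Scope ereal_scope.

Lemma measurable_partial_integral m (G : measurableTypeR R * 'rV[R]_m -> \bar R) :
  measurable_fun setT G -> (forall p, 0 <= G p) ->
  measurable_fun setT (fun y => \int[leb]_t G (t, y)).
Proof. by move=> mG G0; exact: (@measurable_fun_fubini_tonelli_G _ _ _ _ _ leb G). Qed.

Lemma integral_lebesgue_rVS m (F : 'rV[R]_m.+1 -> \bar R) :
  measurable_fun setT F -> (forall x, 0 <= F x) ->
  \int[lebesgue_rV R m.+1]_x F x =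
  \int[lebesgue_rV R m]_y \int[leb]_t F (vcons (t, y)).
Proof.
move=> mF F0.
rewrite (_ : \int[_]_x F x = \int[leb \x lebesgue_rV R m]_p F (vcons p)).
  have mFv : measurable_fun setT (fun p => F (@vcons m p)).
    exact: measurableT_comp mF (@measurable_vcons m).
  rewrite fubini_tonelli1// fubini_tonelli//; exact: mFv.
exact: (ge0_integral_pushforward (@measurable_vcons m)
  [the measure _ _ of leb \x lebesgue_rV R m] measurableT mF).
Qed.

Lemma lebesgue_rVS m (A : set 'rV[R]_m.+1) :
  lebesgue_rV R m.+1 A = (leb \x lebesgue_rV R m) (@vcons m @^-1` A).
Proof. by []. Qed.

(** Lebesgue measure is the only measure with the right values on half-open
intervals, so the case of intervals suffices. *)
Lemma integral_scale1 (c : R) (F : R -> \bar R) : (c != 0)%R ->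
  measurable_fun setT F -> (forall x, 0 <= F x) ->
  \int[leb]_x F x = `|c|%:E * \int[leb]_x F (c * x)%R.
Proof.
move=> c0 mF F0.
have mc : measurable_fun [set: measurableTypeR R] (fun x : measurableTypeR R => (c * x)%R : measurableTypeR R).
  exact: measurable_funM.
have nc0 : (0 <= `|c|)%R by [].
pose nu : {measure set (measurableTypeR R) -> \bar R} :=
  measure_function_pushforward__canonical__measure_function_Measure leb mc.
pose mu : {measure set (measurableTypeR R) -> \bar R} := mscale (NngNum nc0) nu.
have E A : measurable A -> leb A = mu A.
  apply: lebesgue_measure_unique => _ [[a b] _ <-] /=.
  rewrite /mu /mscale /= /pushforward.
  have [cpos|cneg] := ltP 0%R c.
    rewrite (_ : _ @^-1` _ = `](a / c)%R, (b / c)%R]%classic); last first.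
      apply/seteqP; split=> x /=; rewrite !in_itv/= ltr_pdivrMr// ler_pdivlMr//;
        by rewrite mulrC.
    rewrite !lebesgue_measure_itv/= !lte_fin ltr_pM2r ?invr_gt0//.
    case: ifP => ab; last by rewrite mule0.
    by rewrite gtr0_norm// -!EFinD -EFinM; congr EFin; field.
  have {}cneg : (c < 0)%R by rewrite lt_neqAle c0.
  rewrite (_ : _ @^-1` _ = `[(b / c)%R, (a / c)%R[%classic); last first.
    apply/seteqP; split=> x /=; rewrite !in_itv/= ler_ndivrMr// ltr_ndivlMr//;
      by rewrite andbC mulrC.
  rewrite !lebesgue_measure_itv/= !lte_fin ltr_nM2r ?invr_lt0//.
  case: ifP => ab; last by rewrite mule0.
  by rewrite ltr0_norm// -!EFinD -EFinM; congr EFin; field.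
rewrite (_ : \int[leb]_x F x = \int[mu]_x F x); last first.
  by apply: eq_measure_integral => A mA _; rewrite -E.
rewrite ge0_integral_mscale//=; congr (_ * _).
by rewrite ge0_integral_pushforward.
Qed.

Lemma scaler_vcons m (c : R) p :
  (c *: @vcons m p)%R = vcons ((c * p.1)%R, (c *: p.2)%R).
Proof.
apply: (etrans (@scale_row_mx R 1 1 m c (p.1)%:M p.2)); congr row_mx.
by apply/matrixP => i j; rewrite !mxE (ord1 i) (ord1 j) eqxx.
Qed.

Lemma measurable_scaler m (c : R) :
  measurable_fun setT (fun x : 'rV[R]_m => c *: x)%R.
Proof.
apply: measurable_fun_rV => i; under eq_fun do rewrite mxE.
by apply: measurable_funM => //; exact: measurable_coord.
Qed.

(** Negative factors are included: [c = -1] is the central symmetry. *)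
Lemma integral_scale m (c : R) (F : 'rV[R]_m -> \bar R) : (c != 0)%R ->
  measurable_fun setT F -> (forall x, 0 <= F x) ->
  \int[lebesgue_rV R m]_x F x =
  (`|c| ^+ m)%:E * \int[lebesgue_rV R m]_x F (c *: x)%R.
Proof.
move=> c0; elim: m F => [|m IH] F mF F0.
  rewrite expr0 mul1e; apply: eq_integral => x _.
  by rewrite (thinmx0 x) (thinmx0 (c *: _)%R).
have mFv : measurable_fun setT (fun p => F (@vcons m p)).
  exact: measurableT_comp mF (@measurable_vcons m).
have mFc : measurable_fun setT (fun x : 'rV[R]_m.+1 => F (c *: x)%R).
  exact: measurableT_comp mF (measurable_scaler c).
rewrite integral_lebesgue_rVS// integral_lebesgue_rVS//.
under [X in _ = _ * X]eq_integral => y _ do under eq_integral => t _ do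
  rewrite scaler_vcons/=.
rewrite IH; last 2 first.
- exact: (measurable_partial_integral mFv).
- by move=> y; apply: integral_ge0.
rewrite exprS mulrC EFinM -muleA; congr (_ * _).
rewrite -ge0_integralZl//; last 2 first.
- apply: (measurable_partial_integral
    (G := fun p => F (vcons ((c * p.1)%R, (c *: p.2)%R)))) => //.
  rewrite (_ : (fun _ => _) = (fun p => F (c *: vcons p)%R)).
    exact: measurableT_comp mFc (@measurable_vcons m).
  by apply/funext => p; rewrite scaler_vcons.
- by move=> y _; apply: integral_ge0.
apply: eq_integral => y _.
rewrite (integral_scale1 c0 (F := fun t => F (vcons (t, (c *: y)%R))))//.
apply: (measurableT_comp mFv (pair2_measurable _)).
Qed.

Definition box m (a : 'I_m -> R) : set 'rV[R]_m :=
  [set x | forall i, (`|x ord0 i| <= a i)%R].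

Lemma measurable_box m (a : 'I_m -> R) : measurable (box a).
Proof.
rewrite (_ : box a = \big[setI/setT]_(i < m)
    ((fun x : 'rV[R]_m => x ord0 i) @^-1` `[(- a i)%R, a i]%classic)).
  apply: bigsetI_measurable => i _; rewrite -[X in measurable X]setTI.
  exact: measurable_coord.
rewrite -bigcap_seq; apply/seteqP; split => [x H i _|x H i] /=.
  by rewrite in_itv/= -ler_norml.
by have := H i (mem_index_enum _); rewrite /= in_itv/= -ler_norml.
Qed.

Lemma lebesgue_box m (a : 'I_m -> R) : (forall i, 0 <= a i)%R ->
  lebesgue_rV R m (box a) = (\prod_i (2 * a i))%:E.
Proof.
elim: m a => [|m IH] a a0.
  rewrite big_ord0 /= diracE mem_set// => i; by case: i.
rewrite lebesgue_rVS big_ord_recl EFinM -IH; last by move=> i.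
rewrite (_ : _ @^-1` _ = `[(- a ord0)%R, a ord0] `*`
    box (fun i => a (lift ord0 i))); last first.
  apply/seteqP; split => [p H|p [H1 H2] i] /=.
    split=> [|i] /=; first by rewrite in_itv/= -ler_norml -(vcons0 p).
    by rewrite -(vconsS p); exact: H.
  have [->|[j ->]] : i = ord0 \/ exists j, i = lift ord0 j.
    by case: (unliftP ord0 i) => [j ->|->]; [right; exists j|left].
  - by rewrite vcons0 ler_norml; move: H1; rewrite /= in_itv.
  - by rewrite vconsS; exact: H2.
rewrite product_measure1E//; last exact: measurable_box.
congr (_ * _); apply: (etrans (lebesgue_measure_itv `[(- a ord0)%R, a ord0])).
rewrite /= lte_fin.
case: ifPn => h; first by rewrite -EFinD; congr EFin; ring.
have -> : a ord0 = 0%R by have := a0 ord0; lra.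
by rewrite mulr0.
Qed.

Lemma lebesgue_box_fin m (a : 'I_m -> R) : lebesgue_rV R m (box a) < +oo.
Proof.
apply: (@le_lt_trans _ _ (lebesgue_rV R m (box (fun i => `|a i|%R)))).
  apply: le_measure; rewrite ?inE; [exact: measurable_box..|].
  by move=> x H i; exact: le_trans (H i) (ler_norm _).
by rewrite lebesgue_box// ltry.
Qed.

End lebesgue_rV_theory.

(** * The gnomonic substitution *)

Section substitution.
Context {R : realType}.
Local Notation leb := (@lebesgue_measure R).
Implicit Types r s t : R.

(** The point at distance [r] from the first axis whose direction has height
[s] along this axis has first coordinate [gnomonic r s]. *)
Definition gnomonic r s : R := r * (s * (1 - s ^+ 2) `^ (- 2^-1)).

Lemma onem_sqr_gt0 s : -1 < s < 1 -> 0 < 1 - s ^+ 2.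
Proof. by move=> /andP[s1 s2]; nra. Qed.

Lemma is_derive_onem_sqr s : is_derive s 1 (fun t : R => 1 - t ^+ 2) (- (2 * s)).
Proof.
have d1 := @is_derive_cst R R^o R^o 1 s 1.
have d2 := is_deriveX 2 (@is_derive_id R R^o s 1).
have -> : (fun t : R => 1 - t ^+ 2) = (cst (1 : R) - id ^+ 2).
  by apply/funext => t; rewrite !fctE.
apply: (is_derive_eq (is_deriveB d1 d2)).
by rewrite scaleRoE /= expr1 mulr1 sub0r.
Qed.

Lemma is_derive_gnomonic r s : -1 < s < 1 ->
  is_derive s 1 (gnomonic r) (r * (1 - s ^+ 2) `^ (- (3 / 2))).
Proof.
move=> /onem_sqr_gt0 s1.
have dr := @is_derive_cst R R^o R^o r s 1.
have di := @is_derive_id R R^o s 1.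
have dp := is_derive_comp_dir (is_derive_onem_sqr s) (is_derive1_powR (- 2^-1) s1).
apply: (is_derive_eq (is_deriveM dr (is_deriveM di dp))).
rewrite !scaleRoE !fctE mulr0 addr0 mulr1.
have -> : - 2^-1 - 1 = - (3 / 2) :> R by lra.
have -> : (1 - s ^+ 2) `^ (- 2^-1) = (1 - s ^+ 2) `^ (- (3 / 2)) * (1 - s ^+ 2).
  have E : - 2^-1 = - (3 / 2) + 1 :> R by lra.
  by rewrite {1}E powRD ?powRr1 ?(ltW s1)// (gt_eqF s1) implybT.
by field.
Qed.

Lemma continuous_dgnomonic r s : -1 < s < 1 ->
  {for s, continuous (fun s => r * (1 - s ^+ 2) `^ (- (3 / 2)))}.
Proof.
move=> s1; apply: continuousM; first exact: cvg_cst.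
apply: (@continuous_comp _ _ _ (fun s : R => 1 - s ^+ 2) (fun x => x `^ _)).
  apply/differentiable_continuous/derivable1_diffP.
  by have [] := is_derive_onem_sqr s.
apply/differentiable_continuous/derivable1_diffP.
by have [] := is_derive1_powR (- (3 / 2)) (onem_sqr_gt0 s1).
Qed.

Lemma nbhs_oo s : -1 < s < 1 -> \forall x \near s, -1 < x < 1.
Proof.
move=> s1; have : nbhs s `]-1, 1[%classic by apply: near_in_itvoo; rewrite in_itv.
by apply: filterS => x /=; rewrite in_itv.
Qed.

Lemma derive1_gnomonic r s : -1 < s < 1 ->
  derive1 (gnomonic r) s = r * (1 - s ^+ 2) `^ (- (3 / 2)).
Proof.
by move=> s1; rewrite derive1E; have [_ ->] := is_derive_gnomonic r s1.
Qed.

Lemma continuous_derive1_gnomonic r s : -1 < s < 1 ->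
  {for s, continuous (derive1 (gnomonic r))}.
Proof.
move=> s1; rewrite /prop_for /continuous_at derive1_gnomonic//.
have := @continuous_dgnomonic r s s1; rewrite /prop_for /continuous_at.
apply: cvg_trans; apply: near_eq_cvg; near=> x; rewrite derive1_gnomonic//.
by near: x; exact: nbhs_oo.
Unshelve. all: by end_near. Qed.

Lemma continuous_gnomonic r s : -1 < s < 1 -> {for s, continuous (gnomonic r)}.
Proof.
move=> s1; apply/differentiable_continuous/derivable1_diffP.
by have [] := is_derive_gnomonic r s1.
Qed.

Lemma gnomonic_homo r s t : 0 < r -> 0 <= s -> s < t -> t < 1 ->
  gnomonic r s < gnomonic r t.
Proof.
move=> r0 s0 st t1; rewrite /gnomonic ltr_pM2l// !powRN.
have s1 : 0 < 1 - s ^+ 2 by apply: onem_sqr_gt0; lra.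
have t2 : 0 < 1 - t ^+ 2 by apply: onem_sqr_gt0; lra.
apply: (@le_lt_trans _ _ (s * ((1 - t ^+ 2) `^ 2^-1)^-1)).
  rewrite ler_wpM2l// lef_pV2 ?posrE ?powR_gt0//.
  by apply: ge0_ler_powR; rewrite ?nnegrE ?(ltW s1) ?(ltW t2)//; nra.
by rewrite ltr_pM2r// invr_gt0 powR_gt0.
Qed.

Lemma gnomonicK r s : 0 < r -> -1 < s < 1 ->
  (Num.sqrt (gnomonic r s ^+ 2 + r ^+ 2))^-1 * gnomonic r s = s.
Proof.
move=> r0 /onem_sqr_gt0 s1; rewrite /gnomonic powRN powR12_sqrt ?ltW//.
have q0 : 0 < Num.sqrt (1 - s ^+ 2) by rewrite sqrtr_gt0.
have -> : (r * (s / Num.sqrt (1 - s ^+ 2))) ^+ 2 + r ^+ 2 =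
    (r / Num.sqrt (1 - s ^+ 2)) ^+ 2.
  rewrite !exprMn !exprVn sqr_sqrtr ?ltW//; field.
  by rewrite gt_eqF.
rewrite sqrtr_sqr gtr0_norm ?divr_gt0//; field.
by rewrite !gt_eqF.
Qed.

Local Open Scope ereal_scope.

(** At distance [r] from the axis, the unit ball is met along the heights
[|t| <= sqrt(1 - r^2)]; the endpoint is a fixed point of [gnomonic r], as the
point is then a unit vector. So [t = gnomonic r s] maps [0 <= s <= sqrt(1 - r^2)]
onto the part of the ball that [H] sees. *)
Lemma gnomonic_substitution r (H : R -> R) : (0 <= r)%R -> continuous H ->
  (forall t, (t <= 0)%R -> H t = 0%R) -> (forall t, (1 <= t)%R -> H t = 0%R) ->
  \int[leb]_t ((0 < Num.sqrt (t ^+ 2 + r ^+ 2) <= 1)%R%:R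
     * H ((Num.sqrt (t ^+ 2 + r ^+ 2))^-1 * t))%:E =
  \int[leb]_s (H s * (1 - s ^+ 2) `^ (- (3 / 2))
     * (r * (r ^+ 2 <= 1 - s ^+ 2)%R%:R))%:E.
Proof.
move=> r0 cH Hn Hp.
have [{r0}r0|r0'] := ltP 0%R r; last first.
  have -> : r = 0%R by apply/eqP; rewrite eq_le r0' r0.
  rewrite !integral0_eq// => t _; rewrite ?mul0r ?mulr0//.
  rewrite expr0n addr0 sqrtr_sqr; have [t0|t0] := leP t 0%R.
    by rewrite Hn ?mulr0// mulr_ge0_le0// invr_ge0.
  by rewrite gtr0_norm// mulVf ?gt_eqF// Hp// mulr0.
have [r1|r1] := ltP 1%R r.
  rewrite !integral0_eq// => t _.
    have /negPf -> : ~~ (r ^+ 2 <= 1 - t ^+ 2)%R by rewrite -ltNge; nra.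
    by rewrite !mulr0.
  have /negPf -> : ~~ (0 < Num.sqrt (t ^+ 2 + r ^+ 2) <= 1)%R.
    rewrite negb_and -!ltNge; apply/orP; right.
    rewrite -[ltLHS]sqrtr1 ltr_sqrt; nra.
  by rewrite mul0r.
pose rho : R := Num.sqrt (1 - r ^+ 2).
have rho0 : (0 <= rho)%R by exact: sqrtr_ge0.
have rho2 : (rho ^+ 2 = 1 - r ^+ 2)%R by rewrite sqr_sqrtr//; nra.
have rho1 : (rho < 1)%R by nra.
have itv_ok s : s \in `[0%R, rho] -> (-1 < s < 1)%R.
  by rewrite in_itv/= => /andP[s0 s1]; apply/andP; split; lra.
have ok0 : (-1 < (0 : R) < 1)%R by apply/andP; split; lra.
have okr : (-1 < rho < 1)%R by apply/andP; split; lra.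
pose G (t : R) : R := H ((Num.sqrt (t ^+ 2 + r ^+ 2))^-1 * t)%R.
have cG : continuous G.
  move=> t; apply: (@continuous_comp _ _ _
    (fun t : R => (Num.sqrt (t ^+ 2 + r ^+ 2))^-1 * t)%R H); last exact: cH.
  apply: continuousM; last exact: cvg_id.
  apply: continuousV.
    by rewrite gt_eqF// sqrtr_gt0; nra.
  apply: (@continuous_comp _ _ _ (fun t : R => t ^+ 2 + r ^+ 2)%R Num.sqrt).
    by apply: continuousD; [exact: exprn_continuous|exact: cvg_cst].
  exact: sqrt_continuous.
have g0 : gnomonic r 0 = 0%R by rewrite /gnomonic mul0r mulr0.
have grho : gnomonic r rho = rho.
  rewrite /gnomonic rho2 opprB addrCA subrr addr0 powRN powR12_sqrt ?sqr_ge0//.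
  by rewrite sqrtr_sqr gtr0_norm//; field; rewrite gt_eqF.
transitivity (\int[leb]_(t in `[gnomonic r 0, gnomonic r rho]) (G t)%:E).
  rewrite g0 grho [RHS]integral_mkcond; apply: eq_integral => t _.
  rewrite /patch; case: ifPn => [|tr].
    rewrite inE/= in_itv/= => /andP[t0 tr].
    have -> : (0 < Num.sqrt (t ^+ 2 + r ^+ 2) <= 1)%R.
      rewrite sqrtr_gt0 -[X in (_ <= X)%R]sqrtr1 ler_sqrt//.
      by apply/andP; split; nra.
    by rewrite mul1r.
  have [t0|t0] := leP t 0%R.
    by rewrite Hn ?mulr0// mulr_ge0_le0// invr_ge0.
  have tr' : (rho < t)%R.
    by rewrite ltNge; apply: contra tr => tr; rewrite inE/= in_itv/= tr ltW.
  have /negPf -> : ~~ (0 < Num.sqrt (t ^+ 2 + r ^+ 2) <= 1)%R.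
    rewrite negb_and -!ltNge; apply/orP; right.
    rewrite -[ltLHS]sqrtr1 ltr_sqrt; nra.
  by rewrite mul0r.
rewrite (@integration_by_substitution_increasing _ (gnomonic r) G 0 rho)//.
- rewrite [LHS]integral_mkcond; apply: eq_integral => s _.
  rewrite /patch; case: ifPn => [|sr].
    rewrite inE/= => sr; have s1 := itv_ok _ sr.
    rewrite !fctE derive1_gnomonic// /G gnomonicK//.
    have -> : (r ^+ 2 <= 1 - s ^+ 2)%R.
      by move: sr; rewrite in_itv/= => /andP[s0 s2]; nra.
    by congr EFin; rewrite mulr1; ring.
  have [s0|s0] := leP s 0%R; first by rewrite Hn// !mul0r.
  have sr' : (rho < s)%R.
    by rewrite ltNge; apply: contra sr => sr; rewrite inE/= in_itv/= sr ltW.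
  have /negPf -> : ~~ (r ^+ 2 <= 1 - s ^+ 2)%R by rewrite -ltNge; nra.
  by rewrite !mulr0.
- move=> x y; rewrite !in_itv/= => /andP[x0 xr] /andP[y0 yr] xy.
  by apply: gnomonic_homo => //; lra.
- move=> x; rewrite in_itv/= => /andP[x0 xr].
  by apply: continuous_derive1_gnomonic; apply/andP; split; lra.
- apply/cvg_ex; exists (derive1 (gnomonic r) 0).
  by apply: cvg_at_right_filter; exact: continuous_derive1_gnomonic.
- apply/cvg_ex; exists (derive1 (gnomonic r) rho).
  by apply: cvg_at_left_filter; exact: continuous_derive1_gnomonic.
- split.
  + move=> x; rewrite in_itv/= => /andP[x0 xr].
    have x1 : (-1 < x < 1)%R by apply/andP; split; lra.
    by have [] := is_derive_gnomonic r x1.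
  + by apply: cvg_at_right_filter; exact: continuous_gnomonic.
  + by apply: cvg_at_left_filter; exact: continuous_gnomonic.
- exact: continuous_subspaceT.
Qed.

End substitution.

(** * Integration over the sphere *)

Section sphere_integral.
Context {R : realType}.
Local Notation leb := (@lebesgue_measure R).
Local Open Scope ereal_scope.

Definition in_ball n (x : 'rV[R]_n) : bool := (0 < enorm x <= 1)%R.

Lemma measurable_in_ball n : measurable [set x : 'rV[R]_n | in_ball x].
Proof. exact: measurable_eball. Qed.

Lemma measurable_fun_in_ball n :
  measurable_fun setT (fun x : 'rV[R]_n => (in_ball x)%:R : R).
Proof.
rewrite (_ : (fun _ => _) = \1_[set x : 'rV[R]_n | in_ball x]).
  by apply: measurable_indic; exact: measurable_in_ball.
by apply/funext => x; rewrite indicE mem_setE.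
Qed.

(** Sends the complement of the punctured ball to the origin, off the sphere:
on subsets of the sphere, the sphere measure is [n] times the image of the
Lebesgue measure by [shell]. *)
Let shell n (x : 'rV[R]_n) : 'rV[R]_n := ((in_ball x)%:R *: direction x)%R.

Let measurable_shell n : measurable_fun setT (@shell n).
Proof.
apply: measurable_fun_rV => i; under eq_fun do rewrite mxE.
apply: measurable_funM; first exact: measurable_fun_in_ball.
exact: (measurableT_comp (measurable_coord i) measurable_direction).
Qed.

Let shell_sphere n (x : 'rV[R]_n) (A : set 'rV[R]_n) : A `<=` sphere n ->
  (A (shell x)) <-> (in_ball x /\ A (direction x)).
Proof.
rewrite /shell => As; case: (in_ball x); rewrite ?scale1r ?scale0r.
  by split => // -[].
by split=> [/As|[]//]; rewrite /sphere /= enorm0 => /eqP; rewrite eq_sym oner_eq0.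
Qed.

Lemma sphere_integralE n (F : 'rV[R]_n -> \bar R) :
  measurable_fun setT F -> (forall x, 0 <= F x) ->
  \int[sphere_measure n]_(v in sphere n) F v =
  n%:R%:E * \int[lebesgue_rV R n]_x ((in_ball x)%:R%:E * F (direction x)).
Proof.
move=> mF F0.
have n0 : (0 <= n%:R :> R)%R by [].
pose nu : {measure set 'rV[R]_n -> \bar R} :=
  measure_function_pushforward__canonical__measure_function_Measure
    (lebesgue_rV R n) (@measurable_shell n).
pose mu : {measure set 'rV[R]_n -> \bar R} := mscale (NngNum n0) nu.
rewrite (eq_measure_integral mu); last first.
  move=> A mA As; rewrite /mu /mscale /= /pushforward /sphere_measure.
  congr (_ * lebesgue_rV R n _); apply/seteqP; split=> x /=.
    by move=> H; apply/(shell_sphere _ As).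
  by move/(shell_sphere _ As).
rewrite ge0_integral_mscale//; last first.
- exact: measurable_funTS.
- exact: measurable_sphere.
congr (_ * _); rewrite ge0_integral_pushforward//; last first.
- exact: measurable_funTS.
- exact: measurable_sphere.
rewrite integral_mkcond; apply: eq_integral => x _; rewrite /patch.
have E : (x \in (@shell n) @^-1` sphere n) = in_ball x.
  apply/idP/idP => [|xb]; rewrite inE/=; first by case/(shell_sphere _ (fun _ => id)).
  apply/(shell_sphere _ (fun _ => id)); split=> //; apply: sphere_direction.
  by case/andP: xb.
rewrite E /comp /shell; case: (in_ball x); first by rewrite scale1r mul1e.
by rewrite mul0e.
Qed.

Lemma measurable_natr_bool d (T : measurableType d) (b : T -> bool) :
  measurable_fun setT b -> measurable_fun setT (fun x => (b x)%:R : R).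
Proof.
move=> mb; rewrite (_ : (fun _ => _) = \1_[set x | b x]).
  apply: measurable_indic; rewrite (_ : mkset _ = setT `&` b @^-1` [set true]).
    exact: mb.
  by rewrite setTI; apply/seteqP; split=> x /=.
by apply/funext => x; rewrite indicE mem_setE.
Qed.

Definition ball_moment n : \bar R :=
  \int[lebesgue_rV R n]_y (enorm y * (enorm y ^+ 2 <= 1)%R%:R)%:E.

Lemma measurable_ball_moment n (c : R) : measurable_fun setT
  (fun y : 'rV[R]_n => (enorm y * (enorm y ^+ 2 <= c)%R%:R)%R).
Proof.
apply: measurable_funM; first exact: measurable_enorm.
apply: measurable_natr_bool; apply: measurable_fun_ler => //.
exact: (measurableT_comp (exprn_measurable _) measurable_enorm).
Qed.

Lemma ball_moment_scale n (c : R) : (0 < c)%R ->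
  \int[lebesgue_rV R n]_y (enorm y * (enorm y ^+ 2 <= c ^+ 2)%R%:R)%:E =
  (c ^+ n.+1)%:E * ball_moment n.
Proof.
move=> c0; rewrite (integral_scale (lt0r_neq0 c0)); last 2 first.
- by apply/measurable_EFinP; exact: measurable_ball_moment.
- by move=> y; rewrite lee_fin mulr_ge0// enorm_ge0.
rewrite gtr0_norm// [(c ^+ n.+1)%R]exprSr EFinM -muleA; congr (_ * _).
rewrite -ge0_integralZl ?lee_fin ?(ltW c0)//; last 2 first.
- by apply/measurable_EFinP; exact: measurable_ball_moment.
- by move=> y _; rewrite lee_fin mulr_ge0// enorm_ge0.
apply: eq_integral => y _; rewrite enormZ gtr0_norm// -EFinM -mulrA exprMn.
by rewrite -[X in (_ <= X)%R]mulr1 ler_pM2l// exprn_gt0.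
Qed.

Lemma ball_moment_fin n : ball_moment n < +oo.
Proof.
apply: (@le_lt_trans _ _ (\int[lebesgue_rV R n]_y (\1_(box (fun _ : 'I_n => 1%R)) y)%:E)).
  apply: ge0_le_integral => //.
  - by move=> y _; rewrite lee_fin mulr_ge0// enorm_ge0.
  - by apply/measurable_EFinP; exact: measurable_ball_moment.
  - by apply/measurable_EFinP; apply: measurable_indic; exact: measurable_box.
  - move=> y _; rewrite lee_fin; case: (leP (enorm y ^+ 2)%R 1%R) => y1; last first.
      by rewrite mulr0.
    have {}y1 : (enorm y <= 1)%R by have := enorm_ge0 y; nra.
    rewrite indicE mem_set ?mulr1// => i.
    exact: le_trans (coord_le_enorm y i) y1.
rewrite integral_indic ?setIT//; last exact: measurable_box.
exact: lebesgue_box_fin.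
Qed.

(** The moment dominates the one of the region between two cubes inside the
ball, where the norm is bounded below. *)
Lemma ball_moment_gt0 n : (0 < n)%N -> 0 < ball_moment n.
Proof.
case: n => // n _.
(* The cube of half side [c] lies in the ball, as [(n + 1) c^2 <= 1]. *)
pose c : R := (n.+1%:R)^-1%R.
have c0 : (0 < c)%R by rewrite invr_gt0.
have c1 : (c <= 1)%R by rewrite invf_le1// ler1n.
pose b1 : set 'rV[R]_n.+1 := box (fun _ => c).
pose b2 : set 'rV[R]_n.+1 := box (fun _ => (c / 2)%R).
have mb1 : measurable b1 by exact: measurable_box.
have mb2 : measurable b2 by exact: measurable_box.
have b12 : b2 `<=` b1.
  by move=> y H i; apply: le_trans (H i) _; lra.
apply: (@lt_le_trans _ _ (\int[lebesgue_rV R n.+1]_y (c / 2 * \1_(b1 `\` b2) y)%:E)).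
  under eq_integral do rewrite EFinM.
  rewrite ge0_integralZl//; last 2 first.
  - by apply/measurable_EFinP; apply: measurable_indic; exact: measurableD.
  - by rewrite lee_fin divr_ge0// ltW.
  rewrite integral_indic ?setIT//; last exact: measurableD.
  rewrite mule_gt0// ?lte_fin ?divr_gt0//.
  rewrite measureD// ?lebesgue_box_fin// setIidr//.
  change (0%R < lebesgue_rV R n.+1 (box (fun=> c)) - lebesgue_rV R n.+1 (box (fun=> (c / 2)%R))).
  rewrite !lebesgue_box; last 2 first.
  - by move=> i; rewrite divr_ge0// ltW.
  - by move=> i; exact: ltW.
  rewrite -EFinB lte_fin subr_gt0 !prodr_const !card_ord.
  by rewrite ltrXn2r//; lra.
apply: ge0_le_integral => //.
- by move=> y _; rewrite lee_fin mulr_ge0// divr_ge0// ltW.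
- apply/measurable_EFinP; apply: measurable_funM => //.
  by apply: measurable_indic; exact: measurableD.
- by apply/measurable_EFinP; exact: measurable_ball_moment.
move=> y _; rewrite lee_fin indicE.
have [|] := boolP (y \in b1 `\` b2); last first.
  by rewrite mulr0 => _; rewrite mulr_ge0// enorm_ge0.
rewrite inE => -[y1 y2].
have [i yi] : exists i, (c / 2 < `|y ord0 i|)%R.
  by apply: contrapT => /forallNP H; apply: y2 => i; rewrite leNgt; apply/negP/H.
have -> : (enorm y ^+ 2 <= 1)%R.
  rewrite sqr_enorm /dot; apply: (@le_trans _ _ (\sum_(i < n.+1) c)%R).
    apply: ler_sum => j _; apply: le_trans (ler_norm _) _.
    rewrite normrM; have := y1 j; have := normr_ge0 (y ord0 j); nra.
  by rewrite sumr_const card_ord -mulr_natr mulVf.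
by rewrite mulr1 mulr1; exact: le_trans (ltW yi) (coord_le_enorm y i).
Qed.

(** The density, up to a constant, of the height of a uniform random point of the
unit sphere of ['rV[R]_n]. *)
Definition zonal_weight (n : nat) (s : R) : R :=
  ((1 - s ^+ 2) `^ ((n%:R - 3) / 2))%R.

Lemma measurable_onem_sqr : measurable_fun setT (fun s : R => 1 - s ^+ 2)%R.
Proof. by apply: measurable_funB => //; exact: exprn_measurable. Qed.

(** Integrate over the ball, along lines parallel to the first axis: after the
gnomonic substitution the variables [s] and [y] are separated, up to the
condition [|y|^2 <= 1 - s^2], which the scaling of [y] turns into a power of
[1 - s^2]. *)
Lemma zonal_integral_ge0 m (H : R -> R) : continuous H -> (forall t, 0 <= H t)%R ->
  (forall t, (t <= 0)%R -> H t = 0%R) -> (forall t, (1 <= t)%R -> H t = 0%R) ->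
  \int[sphere_measure m.+1]_(v in sphere m.+1) (H (v ord0 ord0))%:E =
  m.+1%:R%:E * ball_moment m * \int[leb]_s (H s * zonal_weight m.+1 s)%:E.
Proof.
move=> cH H0 Hn Hp.
have mH : measurable_fun setT H by exact: continuous_measurable_fun.
have mFH : measurable_fun setT (fun v : 'rV[R]_m.+1 => (H (v ord0 ord0))%:E).
  apply/measurable_EFinP; exact: (measurableT_comp mH (measurable_coord _)).
rewrite sphere_integralE//; last by move=> x; rewrite lee_fin.
rewrite -muleA; congr (_ * _).
rewrite integral_lebesgue_rVS; last 2 first.
- apply: emeasurable_funM.
    by apply/measurable_EFinP; exact: measurable_fun_in_ball.
  exact: (measurableT_comp mFH measurable_direction).
- by move=> x; rewrite mule_ge0// lee_fin.
pose K (s : R) : R := (H s * (1 - s ^+ 2) `^ (- (3 / 2)))%R.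
have K0 s : (0 <= K s)%R by rewrite mulr_ge0// powR_ge0.
have mK : measurable_fun setT K.
  apply: measurable_funM => //.
  exact: (measurableT_comp (measurable_powR _) measurable_onem_sqr).
pose Phi (p : measurableTypeR R * 'rV[R]_m) : R :=
  (K p.1 * (enorm p.2 * (enorm p.2 ^+ 2 <= 1 - p.1 ^+ 2)%R%:R))%R.
transitivity (\int[lebesgue_rV R m]_y \int[leb]_s (Phi (s, y))%:E).
  apply: eq_integral => y _.
  rewrite -(gnomonic_substitution (enorm_ge0 y) cH Hn Hp).
  apply: eq_integral => t _; rewrite -EFinM; congr (_%:E).
  have E : enorm (vcons (t, y)) = Num.sqrt (t ^+ 2 + enorm y ^+ 2).
    by rewrite /enorm dot_vcons/= -expr2 sqr_enorm.
  by rewrite /in_ball /direction mxE vcons0 E.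
have mPhi : measurable_fun setT (EFin \o Phi).
  apply/measurable_EFinP; apply: measurable_funM.
    exact: (measurableT_comp mK measurable_fst).
  have me : measurable_fun setT (fun p : measurableTypeR R * 'rV[R]_m => enorm p.2).
    exact: (measurableT_comp measurable_enorm measurable_snd).
  apply: measurable_funM => //; apply: measurable_natr_bool.
  apply: measurable_fun_ler.
    exact: (measurableT_comp (exprn_measurable _) me).
  exact: (measurableT_comp measurable_onem_sqr measurable_fst).
rewrite -(@fubini_tonelli _ _ _ _ _ leb (lebesgue_rV R m) (EFin \o Phi))//=; last first.
  by move=> p; rewrite lee_fin /Phi mulr_ge0// mulr_ge0// enorm_ge0.
rewrite -ge0_integralZl//; last 3 first.
- apply/measurable_EFinP; apply: measurable_funM => //.
  exact: (measurableT_comp (measurable_powR _) measurable_onem_sqr).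
- by move=> s _; rewrite lee_fin mulr_ge0// powR_ge0.
- by apply: integral_ge0 => y _; rewrite lee_fin mulr_ge0// enorm_ge0.
apply: eq_integral => s _; rewrite /Phi /=.
under eq_integral do rewrite EFinM.
rewrite ge0_integralZl//; last 3 first.
- by apply/measurable_EFinP; exact: measurable_ball_moment.
- by move=> y _; rewrite lee_fin mulr_ge0// enorm_ge0.
- by rewrite lee_fin.
have [s0|s0] := leP s 0%R; first by rewrite /K Hn// !mul0r !mul0e mule0.
have [s1|s1] := leP 1%R s; first by rewrite /K Hp// !mul0r !mul0e mule0.
have s2 : (0 < 1 - s ^+ 2)%R by nra.
have c0 : (0 < Num.sqrt (1 - s ^+ 2))%R by rewrite sqrtr_gt0.
have := ball_moment_scale m c0; rewrite sqr_sqrtr ?(ltW s2)// => ->.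
rewrite muleA -EFinM muleC; congr (_ * _%:E).
rewrite /K /zonal_weight -mulrA; congr (_ * _)%R.
rewrite -powR12_sqrt ?(ltW s2)// -[(_ ^+ m.+1)%R]powR_mulrn ?powR_ge0// -powRrM -powRD ?(gt_eqF s2) ?implybT//.
by congr (_ `^ _)%R; field.
Qed.

End sphere_integral.

Section zonal_integral.
Context {R : realType}.
Local Notation leb := (@lebesgue_measure R).

Lemma continuous_zonal_weight n (s : R) : -1 < s < 1 ->
  {for s, continuous (zonal_weight n : R -> R)}.
Proof.
move=> s1; apply: (@continuous_comp _ _ _ (fun s : R => 1 - s ^+ 2) (fun x => x `^ _)).
  apply/differentiable_continuous/derivable1_diffP.
  by have [] := is_derive_onem_sqr s.
apply/differentiable_continuous/derivable1_diffP.
by have [] := is_derive1_powR ((n%:R - 3) / 2) (onem_sqr_gt0 s1).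
Qed.

Definition pospart (H : R -> R) (t : R) : R := Num.max (H t) 0.

Lemma continuous_pospart H : continuous H -> continuous (pospart H).
Proof.
by move=> cH t; exact: (continuous_max (cH t) (@cst_continuous _ _ (0 : R) t)).
Qed.

Lemma zonal_integral m : (0 < m)%N -> exists2 C : R, 0 < C &
  forall (a b : R) (H : R -> R), 0 < a -> b < 1 -> continuous H ->
    (forall t, ~~ (a <= t <= b) -> H t = 0) ->
  \int[sphere_measure m.+1]_(v in sphere m.+1) H (v ord0 ord0) =
  C * \int[leb]_(t in `[a, b]) (H t * zonal_weight m.+1 t).
Proof.
move=> m0; pose C := fine (m.+1%:R%:E * ball_moment m : \bar R)%E.
have CE : (m.+1%:R%:E * ball_moment m = C%:E :> \bar R)%E.
  rewrite fineK// fin_numM// ge0_fin_numE ?ball_moment_fin//.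
  exact/ltW/ball_moment_gt0.
exists C; first by rewrite -lte_fin -CE mule_gt0// ?lte_fin// ball_moment_gt0.
move=> a b H a0 b1 cH Hab.
have iP (G : R -> R) : continuous G -> (forall t, ~~ (a <= t <= b) -> G t = 0) ->
    leb.-integrable `[a, b] (EFin \o (fun t => G t * zonal_weight m.+1 t)).
  move=> cG Gab; apply: segment_integrable => x /andP[ax xb].
  apply: continuousM; first exact: cG.
  by apply: continuous_zonal_weight; apply/andP; split; lra.
have main (G : R -> R) : continuous G -> (forall t, ~~ (a <= t <= b) -> G t = 0) ->
    (\int[sphere_measure m.+1]_(v in sphere m.+1) (pospart G (v ord0 ord0))%:E =
    C%:E * \int[leb]_(t in `[a, b]) (pospart G t * zonal_weight m.+1 t)%:E)%E.
  move=> cG Gab.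
  have pab t : ~~ (a <= t <= b) -> pospart G t = 0.
    by move=> /Gab; rewrite /pospart => ->; rewrite maxxx.
  rewrite zonal_integral_ge0 ?CE.
  - congr (_ * _)%E; rewrite [RHS]integral_mkcond; apply: eq_integral => t _.
    rewrite /patch; case: ifPn => // tn; rewrite pab ?mul0r//.
    by apply: contra tn => tn; rewrite inE/= in_itv.
  - exact: continuous_pospart.
  - by move=> t; rewrite /pospart le_max lexx orbT.
  - by move=> t t0; rewrite pab//; apply/negP => /andP[]; lra.
  - by move=> t t1; rewrite pab//; apply/negP => /andP[]; lra.
rewrite /Rintegral.
have cN : continuous (fun t => - H t) by move=> t; apply: continuousN; exact: cH.
have Nab t : ~~ (a <= t <= b) -> - H t = 0 by move/Hab => ->; rewrite oppr0.
have w0 t : 0 <= zonal_weight m.+1 t :> R by exact: powR_ge0.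
have pM (x w : R) : 0 <= w -> Num.max (x * w) 0 = Num.max x 0 * w.
  by move=> w0'; rewrite maxr_pMl// mul0r.
rewrite integralE (eq_integral (fun v : 'rV[R]_m.+1 => (pospart H (v ord0 ord0))%:E)); last first.
  by move=> v _; rewrite funeposE /= -EFin_max.
rewrite (eq_integral (fun v : 'rV[R]_m.+1 => (pospart (fun t => - H t) (v ord0 ord0))%:E) (EFin \o _)^\-)%E; last first.
  by move=> v _; rewrite funenegE /= -EFin_max.
rewrite !main// [in RHS]integralE.
have fin (G : R -> R) : continuous G -> (forall t, ~~ (a <= t <= b) -> G t = 0) ->
    (\int[leb]_(t in `[a, b]) (pospart G t * zonal_weight m.+1 t)%:E)%E \is a fin_num.
  move=> cG Gab; apply: integrable_fin_num => //; apply: iP.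
    exact: continuous_pospart.
  by move=> t /Gab; rewrite /pospart => ->; rewrite maxxx.
rewrite -muleBr ?fin_num_adde_defr ?fin//.
rewrite fineM//; last by rewrite fin_numB !fin.
congr (_ * fine (_ - _)%E); apply: eq_integral => t _.
  by rewrite funeposE /= -EFin_max pM.
by rewrite funenegE /= -EFin_max -mulNr pM.
Qed.

End zonal_integral.

(** * The linear projection of a zonal function *)

Section sphere_symmetry.
Context {R : realType}.
Local Notation leb := (@lebesgue_measure R).

Lemma in_ball_box n (x : 'rV[R]_n) : in_ball x -> box (fun=> 1) x.
Proof.
by move=> /andP[_ x1] i; exact: le_trans (coord_le_enorm x i) x1.
Qed.

Lemma sphere_measure_fin n : (sphere_measure n (sphere n) < +oo :> \bar R)%E.
Proof.
rewrite /sphere_measure lte_mul_pinfty ?lee_fin//.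
apply: le_lt_trans (lebesgue_box_fin (fun _ : 'I_n => 1 : R)).
apply: le_measure; rewrite ?inE.
- apply: measurableI; first exact: measurable_eball.
  rewrite -[X in measurable X]setTI; apply: measurable_direction => //.
  exact: measurable_sphere.
- exact: measurable_box.
- by move=> x [xb _]; exact: in_ball_box.
Qed.

Lemma sphere_integrable n (F : 'rV[R]_n -> R) (M : R) :
  measurable_fun setT F -> (forall v, sphere n v -> `|F v| <= M) ->
  (sphere_measure n).-integrable (sphere n) (EFin \o F).
Proof.
move=> mF FM; apply: measurable_bounded_integrable.
- exact: measurable_sphere.
- exact: sphere_measure_fin.
- exact: measurable_funTS.
- exists M; split; first exact: num_real.
  by move=> x Mx v vS; apply: le_trans (FM _ vS) (ltW Mx).
Qed.

(** The symmetry with respect to the first axis. *)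
Definition refl m (v : 'rV[R]_m.+1) : 'rV[R]_m.+1 :=
  \row_i (if i == ord0 then v ord0 i else - v ord0 i).

Lemma refl_vcons m p : refl (@vcons R m p) = vcons (p.1, - p.2).
Proof.
apply/matrixP => i j; rewrite (ord1 i) mxE.
have [->|[k ->]] : j = ord0 \/ exists k, j = lift ord0 k.
  by case: (unliftP ord0 j) => [k ->|->]; [right; exists k|left].
by rewrite !vcons0.
by rewrite !vconsS /= mxE.
Qed.

Lemma enorm_refl m (v : 'rV[R]_m.+1) : enorm (refl v) = enorm v.
Proof.
rewrite /enorm /dot; congr (Num.sqrt _); apply: eq_bigr => i _.
by rewrite mxE; case: ifP => // _; rewrite mulrNN.
Qed.

Lemma direction_refl m (v : 'rV[R]_m.+1) : direction (refl v) = refl (direction v).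
Proof.
apply/matrixP => i j; rewrite (ord1 i) /direction enorm_refl !mxE.
by case: ifP => // _; rewrite mulrN.
Qed.

Lemma measurable_refl m : measurable_fun setT (@refl m).
Proof.
apply: measurable_fun_rV => i; under eq_fun do rewrite mxE.
case: (i == ord0); first exact: measurable_coord.
by apply: measurable_funN; exact: measurable_coord.
Qed.

Lemma sphere_integral_refl m (F : 'rV[R]_m.+1 -> \bar R) :
  measurable_fun setT F -> (forall x, 0 <= F x)%E ->
  (\int[sphere_measure m.+1]_(v in sphere m.+1) F (refl v) =
   \int[sphere_measure m.+1]_(v in sphere m.+1) F v)%E.
Proof.
move=> mF F0.
have mFr : measurable_fun setT (F \o @refl m).
  exact: measurableT_comp mF (@measurable_refl m).
have mball : measurable_fun setT (fun x : 'rV[R]_m.+1 => (in_ball x)%:R%:E : \bar R).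
  by apply/measurable_EFinP; exact: measurable_fun_in_ball.
pose P (G : 'rV[R]_m.+1 -> \bar R) x := ((in_ball x)%:R%:E * G (direction x))%E.
have mP G : measurable_fun setT G -> measurable_fun setT (P G).
  move=> mG; apply: emeasurable_funM => //.
  exact: (measurableT_comp mG measurable_direction).
have P0 G : (forall x, 0 <= G x)%E -> (forall x, 0 <= P G x)%E.
  by move=> G0 x; rewrite mule_ge0// lee_fin.
rewrite [RHS](sphere_integralE mF F0).
apply: etrans (sphere_integralE mFr (fun x => F0 (refl x))) _.
congr (_ * _)%E.
apply: etrans (integral_lebesgue_rVS (mP _ mFr) (P0 _ (fun x => F0 (refl x)))) _.
apply: etrans _ (esym (integral_lebesgue_rVS (mP _ mF) (P0 _ F0))).
have N1 : -1 != 0 :> R by rewrite oppr_eq0 oner_eq0.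
rewrite [RHS](integral_scale N1); last 2 first.
- apply: (measurable_partial_integral (G := fun p => P F (vcons p))).
    exact: (measurableT_comp (mP _ mF) (@measurable_vcons R m)).
  by move=> p; exact: P0.
- by move=> y; apply: integral_ge0 => t _; exact: P0.
rewrite normrN normr1 expr1n mul1e; apply: eq_integral => y _.
apply: eq_integral => t _; rewrite /P /= -direction_refl refl_vcons/= scaleN1r.
by congr (_%:R%:E * _)%E; rewrite /in_ball -(enorm_refl (vcons (t, y))) refl_vcons.
Qed.

(** The symmetry exchanges the positive and the negative part of [F]; when their
common integral is infinite, the difference is still sent to 0. *)
Lemma sphere_integral_odd m (F : 'rV[R]_m.+1 -> R) :
  measurable_fun setT F -> (forall v, F (refl v) = - F v) ->
  \int[sphere_measure m.+1]_(v in sphere m.+1) F v = 0.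
Proof.
move=> mF oF; rewrite /Rintegral integralE.
have -> : (\int[sphere_measure m.+1]_(v in sphere m.+1) (fun v => (F v)%:E)^\- v =
    \int[sphere_measure m.+1]_(v in sphere m.+1) (fun v => (F v)%:E)^\+ v)%E.
  rewrite -sphere_integral_refl//.
    by apply: eq_integral => v _; rewrite funeposE funenegE oF EFinN oppeK.
  by apply: measurable_funeneg; exact/measurable_EFinP.
case: (integral _ _ _) => //= r; by rewrite subrr.
Qed.

(** By symmetry the projection is [a v_0], where [a] is the ratio of the
integrals of [h(v_0) v_0^2] and of [v_0^2]. The factor [t] in [t h(t)] is what
makes this a weighted mean of [h]; the bound also covers the case of a zero
denominator, where the numerator vanishes. *)
Lemma linear_proj_zonal m (h : R -> R) (T : R) : continuous h -> (forall t, `|h t| <= T) ->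
  exists2 a : R, `|a| <= T &
  linear_proj (zonal (fun t => t * h t)) (fun v : 'rV[R]_m.+1 => a * v ord0 ord0).
Proof.
move=> ch hT; have T0 : 0 <= T by exact: le_trans (hT 0).
pose I (F : 'rV[R]_m.+1 -> R) := \int[sphere_measure m.+1]_(v in sphere m.+1) F v.
pose x0 (v : 'rV[R]_m.+1) := v ord0 ord0.
have mx0 : measurable_fun setT x0 by exact: measurable_coord.
have mh : measurable_fun setT (fun v => h (x0 v)).
  by apply: measurableT_comp mx0; exact: continuous_measurable_fun.
have x1 v : sphere m.+1 v -> `|x0 v| <= 1 by exact: sphere_coord_le1.
pose M2 := I (fun v => x0 v * x0 v).
pose A := I (fun v => h (x0 v) * (x0 v * x0 v)).
have i2 : (sphere_measure m.+1).-integrable (sphere m.+1) (EFin \o (fun v => x0 v * x0 v)).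
  apply: (@sphere_integrable _ _ 1); first exact: measurable_funM.
  by move=> v /x1 xv; rewrite normrM mulr_ile1.
have ih : (sphere_measure m.+1).-integrable (sphere m.+1)
    (EFin \o (fun v => h (x0 v) * (x0 v * x0 v))).
  apply: (@sphere_integrable _ _ T).
    by apply: measurable_funM => //; exact: measurable_funM.
  move=> v /x1 xv; rewrite !normrM -[leRHS]mulr1 ler_pM// ?mulr_ge0//.
  by rewrite mulr_ile1.
have mS : measurable (sphere m.+1 : set 'rV[R]_m.+1) by exact: measurable_sphere.
have AM : `|A| <= T * M2.
  apply: le_trans (le_normr_Rintegral mS ih) _.
  rewrite -RintegralZl//; apply: le_Rintegral => //.
  - exact: integrable_norm.
  - exact: (integrableZl mS T i2).
  move=> v _; rewrite normrM -expr2 (ger0_norm (sqr_ge0 _)).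
  by rewrite ler_wpM2r// sqr_ge0.
have M20 : 0 <= M2.
  by apply: Rintegral_ge0 => v _; rewrite -expr2 sqr_ge0.
exists (A / M2).
  have [M2z|M2z] := eqVneq M2 0; first by rewrite M2z invr0 mulr0 normr0.
  have M2p : 0 < M2 by rewrite lt_neqAle eq_sym M2z.
  by rewrite normrM normfV (gtr0_norm M2p) ler_pdivrMr.
have AE : A / M2 * M2 = A.
  have [M2z|M2z] := eqVneq M2 0; last by rewrite divfK.
  by move: AM; rewrite M2z mulr0 mulr0 normr_le0 => /eqP ->.
split.
  exists (\row_i (if i == ord0 then A / M2 else 0)) => v _.
  rewrite /dot big_ord_recl mxE eqxx big1 ?addr0// => i _.
  by rewrite mxE mul0r.
move=> b.
(* The pairing with [b] splits in a multiple of [A - (A / M2) M2 = 0] and the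
   integral of [Q L], which is odd for the symmetry. *)
pose L (v : 'rV[R]_m.+1) := \sum_(i < m) b ord0 (lift ord0 i) * v ord0 (lift ord0 i).
have mL : measurable_fun setT L.
  by apply: measurable_sum => i; apply: measurable_funM => //; exact: measurable_coord.
pose Q v := x0 v * h (x0 v) - A / M2 * x0 v.
have mQ : measurable_fun setT Q.
  apply: measurable_funB; first exact: measurable_funM.
  exact: measurable_funM.
transitivity (I (fun v => b ord0 ord0 * (h (x0 v) * (x0 v * x0 v)
    - A / M2 * (x0 v * x0 v)) + Q v * L v)).
  apply: eq_Rintegral => v _; rewrite /zonal /Q /dot big_ord_recl -/(L v) -/(x0 v).
  by ring.
have iQL : (sphere_measure m.+1).-integrable (sphere m.+1) (EFin \o (fun v => Q v * L v)).
  apply: (@sphere_integrable _ _ ((T + `|A / M2|) * \sum_(i < m) `|b ord0 (lift ord0 i)|)).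
    exact: measurable_funM.
  move=> v vS; rewrite normrM ler_pM//.
    apply: le_trans (ler_normB _ _) _; rewrite !normrM lerD//.
      by rewrite -[leRHS]mul1r ler_pM// x1.
    by rewrite -[leRHS]mulr1 ler_wpM2l// x1.
  apply: le_trans (ler_norm_sum _ _ _) _; apply: ler_sum => i _.
  by rewrite normrM -[leRHS]mulr1 ler_wpM2l// sphere_coord_le1.
have i2a : (sphere_measure m.+1).-integrable (sphere m.+1)
    (EFin \o (fun v => A / M2 * (x0 v * x0 v))) by exact: (integrableZl mS _ i2).
have iB : (sphere_measure m.+1).-integrable (sphere m.+1)
    (EFin \o (fun v => h (x0 v) * (x0 v * x0 v) - A / M2 * (x0 v * x0 v))).
  exact: (integrableB mS ih i2a).
rewrite /I RintegralD//; last exact: (integrableZl mS _ iB).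
rewrite RintegralZl// RintegralB// RintegralZl// -/(I _) -/(I _) -/A -/M2 AE subrr mulr0 add0r.
apply: sphere_integral_odd; first exact: measurable_funM.
move=> v; rewrite /Q /L /x0 mxE /=; apply: (etrans _ (mulrN _ _)).
congr (_ * _); rewrite -sumrN.
by apply: eq_bigr => i _; rewrite mxE /= mulrN.
Qed.

End sphere_symmetry.

(** * The equation satisfied by Berg's function *)

Section berg_test.
Context {R : realType}.
Local Notation leb := (@lebesgue_measure R).
Variables (m : nat) (g : R -> R).
Hypotheses (m0 : (0 < m)%N) (hg : berg_function m.+1 g).

Lemma berg_continuous (t : R) : -1 < t < 1 -> {for t, continuous g}.
Proof.
move=> /andP[t1 t2]; have [cg _ _ _] := hg.
have cg' : {within `]-1, 1[, continuous g}.
  apply: continuous_subspaceW cg => x /=; rewrite !in_itv/= => /andP[x1 x2].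
  by rewrite ltW.
move: cg'; rewrite continuous_open_subspace => [H|]; last exact: interval_open.
by apply: H; rewrite inE/= in_itv/= t1.
Qed.

Lemma continuous_cutoff (a b : R) (N : R -> R) : -1 < a -> b < 1 ->
  continuous N -> (forall t, ~~ (a <= t <= b) -> N t = 0) ->
  continuous (fun t => g t * N t).
Proof.
move=> a1 b1 cN N0 t; have [tab|tab] := boolP (a <= t <= b).
  apply: continuousM; last exact: cN.
  by apply: berg_continuous; move: tab => /andP[]; lra.
rewrite /continuous_at N0// mulr0.
have := @cst_continuous R R (0 : R) t; apply: cvg_trans.
apply: near_eq_cvg; near=> x; rewrite N0 ?mulr0//; near: x.
exact: near_notin_segment.
Unshelve. all: by end_near. Qed.

(** The defining identity at the pole, for the zonal function [f(v_0)] with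
[f(t) = t h(t)]. As [f] vanishes at the pole, the integral is the value there of
the projection of [f], up to sign, hence at most [sup |h|]. *)
Lemma berg_test : exists2 C : R, 0 <= C & forall (a b T : R) (h h1 h2 : R -> R),
  0 < a -> b < 1 -> (forall k, C1 k [set: R] h) ->
  (forall t : R, is_derive t 1 h (h1 t)) ->
  (forall t : R, is_derive t 1 h1 (h2 t)) -> continuous h2 ->
  (forall t, ~~ (a <= t <= b) -> [/\ h t = 0, h1 t = 0 & h2 t = 0]) ->
  (forall t, `|h t| <= T) ->
  `|\int[leb]_(t in `[a, b]) (g t * (m%:R^-1 * ((1 - t ^+ 2) *
      (2 * h1 t + t * h2 t) - m%:R * t ^+ 2 * h1 t)) * zonal_weight m.+1 t)|
  <= C * T.
Proof.
have [C C0 hC] := @zonal_integral R m m0.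
exists C^-1; first by rewrite invr_ge0 ltW.
move=> a b T h h1 h2 a0 b1 ch dh dh1 ch2 hab hT.
have cont_h := is_derive_continuous dh.
have cont_h1 := is_derive_continuous dh1.
pose N (t : R) : R := m%:R^-1 * ((1 - t ^+ 2) * (2 * h1 t + t * h2 t) - m%:R * t ^+ 2 * h1 t).
have N0 t : ~~ (a <= t <= b) -> N t = 0.
  by move=> /hab[_ h10 h20]; rewrite /N h10 h20; ring.
have cX : continuous (fun t : R => t ^+ 2) by exact: exprn_continuous.
have cN : continuous N.
  rewrite /N => t; refine (@continuousM R R (fun=> m%:R^-1) (fun t : R => (1 - t ^+ 2) * (2 * h1 t + t * h2 t) - m%:R * t ^+ 2 * h1 t) t _ _); first exact: cst_continuous.
  apply: continuousB.
    apply: continuousM; first by apply: continuousB; [exact: cst_continuous|exact: cX].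
    apply: continuousD.
      by apply: continuousM; [exact: cst_continuous|exact: cont_h1].
    by apply: continuousM; [exact: cvg_id|exact: ch2].
  apply: continuousM; last exact: cont_h1.
  by apply: continuousM; [exact: cst_continuous|exact: cX].
have a1 : -1 < a by lra.
have E := hC a b _ a0 b1 (continuous_cutoff a1 b1 cN N0).
have {}E := E (fun t ht => etrans (congr1 (fun z => g t * z) (N0 t ht)) (mulr0 _)).
have [al alT pal] := linear_proj_zonal m cont_h hT.
have [_ _ _ H] := hg.
pose f (t : R) : R := t * h t.
have df (t : R) : is_derive t 1 f (h t + t * h1 t).
  apply: (is_derive_eq (is_deriveM (@is_derive_id R R^o t 1) (dh t))).
  by rewrite !scaleRoE mulr1 addrC.
have df1 (t : R) : is_derive t 1 (fun t => h t + t * h1 t) (2 * h1 t + t * h2 t).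
  apply: (is_derive_eq (is_deriveD (dh t)
    (is_deriveM (@is_derive_id R R^o t 1) (dh1 t)))).
  by rewrite !scaleRoE; ring.
have sf : smooth_sphere (zonal f : 'rV[R]_m.+1 -> R).
  apply: smooth_zonal => k; apply: Cdir_mul; [exact: openT| |exact: ch].
  exact: C1_id openT.
pose u : 'rV[R]_m.+1 := 'e_ord0.
have dotu v : dot u v = v ord0 ord0.
  rewrite /dot (bigD1 ord0)//= mxE !eqxx mul1r big1 ?addr0// => i i0.
  by rewrite mxE (negPf i0) andbF mul0r.
have uS : sphere m.+1 u by rewrite /sphere /= /enorm dotu mxE !eqxx sqrtr1.
have := H _ _ sf pal u uS.
have -> : zonal f u = 0.
  by rewrite /zonal /f /u mxE !eqxx mul1r; have [|->] := hab 1 => //; apply/negP => /andP[]; lra.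
have -> : u ord0 ord0 = 1 by rewrite mxE !eqxx.
rewrite mulr1 sub0r => {}H.
have {H}E2 : \int[sphere_measure m.+1]_(v in sphere m.+1) (g (v ord0 ord0) * N (v ord0 ord0)) = - al.
  rewrite -H; apply: eq_Rintegral => v; rewrite inE => vS.
  rewrite dotu (sphere_laplacian_zonal df df1 vS) /N /zonal /f; congr (_ * _).
  move: (v ord0 ord0) => t; have mn0 : m%:R != 0 :> R by rewrite pnatr_eq0 -lt0n.
  by field.
rewrite E2 in E.
have -> : (\int[leb]_(t in `[a, b]) (g t * N t * zonal_weight m.+1 t)) = - (C^-1 * al).
  by rewrite -mulrN E mulKf// gt_eqF.
by rewrite normrN normrM gtr0_norm ?invr_gt0// ler_wpM2l// invr_ge0 ltW.
Qed.

End berg_test.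

Section weighted_profiles.
Context {R : realType}.
Local Notation leb := (@lebesgue_measure R).
Variables (m : nat) (g : R -> R).

(** [1 / (t^2 P)], where [P = (1 - t^2)^(m/2)]. *)
Definition ode_weight (t : R) : R := t `^ (- 2) * (1 - t ^+ 2) `^ (- (m%:R / 2)).

Lemma ode_weight_ge0 t : 0 <= ode_weight t.
Proof. by rewrite mulr_ge0// powR_ge0. Qed.

Lemma ode_weight_gt0 t : 0 < t < 1 -> 0 < ode_weight t.
Proof.
move=> /andP[t0 t1]; rewrite mulr_gt0// powR_gt0// onem_sqr_gt0//.
by apply/andP; split; lra.
Qed.

Lemma ode_weight_le t b : 2^-1 <= t -> t <= b -> b < 1 ->
  ode_weight t <= 4 * (1 - b) `^ (- (m%:R / 2)).
Proof.
move=> t2 tb b1; rewrite /ode_weight ler_pM ?powR_ge0//.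
  rewrite (powR_invn 2) ?(le_trans _ t2)// -[leRHS]invrK lef_pV2 ?posrE ?exprn_gt0 ?invr_gt0//; first by nra.
  by lra.
rewrite !powRN lef_pV2 ?posrE ?powR_gt0 ?subr_gt0//; last by nra.
by apply: ge0_ler_powR; rewrite ?nnegrE ?divr_ge0//; nra.
Qed.

Definition dlog_ode_weight (t : R) : R := m%:R * t / (1 - t ^+ 2) - 2 / t.

Lemma is_derive_ode_weight (t : R) : 0 < t < 1 ->
  is_derive t 1 ode_weight (ode_weight t * dlog_ode_weight t).
Proof.
move=> t01; have /andP[t0 t1] := t01.
have s0 : 0 < 1 - t ^+ 2 by apply: onem_sqr_gt0; apply/andP; split; lra.
have d1 := is_derive1_powR (- 2) t0.
have d2 := is_derive_comp_dir (is_derive_onem_sqr t) (is_derive1_powR (- (m%:R / 2)) s0).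
apply: (is_derive_eq (is_deriveM d1 d2)).
rewrite !scaleRoE /ode_weight /dlog_ode_weight.
have E (x a : R) : 0 < x -> x `^ (a - 1) = x `^ a / x.
  by move=> x0; rewrite powRB ?powRr1 ?ltW// (gt_eqF x0) implybT.
rewrite !E//; field.
by rewrite !gt_eqF.
Qed.

Lemma open01 : open [set t : R | 0 < t < 1].
Proof.
rewrite (_ : mkset _ = `]0, 1[%classic); first exact: interval_open.
by apply/seteqP; split=> t /=; rewrite in_itv.
Qed.

Lemma C1_ode_weight k : C1 k [set t : R | 0 < t < 1] ode_weight.
Proof.
apply: Cdir_mul; first exact: open01.
  apply: (C1_comp (q := id) open01 open_gt0 _ (C1_powR k _)).
    by move=> t /= /andP[].
  exact: C1_id open01.
apply: (C1_comp (q := fun t => 1 - t ^+ 2) open01 open_gt0 _ (C1_powR k _)).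
  by move=> t /= /andP[t0 t1]; apply: onem_sqr_gt0; apply/andP; split; lra.
rewrite (_ : (fun t : R => 1 - t ^+ 2) = fun t => 1 + (-1 * t) * t); last first.
  by apply/funext => t; ring.
apply: Cdir_add; [exact: open01|exact: Cdir_cst open01|].
apply: Cdir_mul; [exact: open01| |exact: C1_id open01].
by apply: Cdir_mul; [exact: open01|exact: Cdir_cst open01|exact: C1_id open01].
Qed.

Section test_function.
Variables (a b : R) (k k1 : R -> R).
Hypotheses (a0 : 0 < a) (b1 : b < 1).
Hypothesis ck : forall j, C1 j [set: R] k.
Hypothesis kout : forall t, ~~ (a <= t <= b) -> k t = 0.

(** The derivative of a profile [h]. Multiplying by [k] hides the
singularities of the weight at 0 and 1. *)
Let pw t := k t * ode_weight t.

Lemma C1_weighted j : C1 j [set: R] pw.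
Proof.
have -> : [set: R] = [set t | 0 < t < 1] `|` [set t | ~~ (a <= t <= b)].
  apply/seteqP; split=> // t _ /=.
  have [/andP[ta tb]|] := boolP (a <= t <= b); [left|by right].
  by rewrite (lt_le_trans a0 ta) (le_lt_trans tb b1).
apply: C1_union.
  apply: Cdir_mul; [exact: open01| |exact: C1_ode_weight].
  exact: C1_subset (@subsetT _ _) (ck j).
apply: (@Cdir_eq _ _ _ _ _ _ (cst 0)); [exact: open_notin_segment| |].
  by move=> t /= /kout kt; rewrite /pw kt mul0r.
exact: Cdir_cst (@open_notin_segment _ _ _).
Qed.

Hypothesis dk : forall t : R, is_derive t 1 k (k1 t).

Definition dweighted (t : R) : R := (k1 t + k t * dlog_ode_weight t) * ode_weight t.

Lemma is_derive_weighted (t : R) : is_derive t 1 pw (dweighted t).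
Proof.
have [/andP[ta tb]|tab] := boolP (a <= t <= b).
  have t01 : 0 < t < 1 by rewrite (lt_le_trans a0 ta) (le_lt_trans tb b1).
  apply: (is_derive_eq (is_deriveM (dk t) (is_derive_ode_weight t01))).
  by rewrite !scaleRoE /dweighted; ring.
rewrite /dweighted (is_derive_outside dk kout tab) (kout tab) mul0r addr0 mul0r.
apply: (@near_eq_is_derive _ _ _ (cst 0)) => //.
near=> y; rewrite /pw kout ?mul0r//; near: y; exact: near_notin_segment.
Unshelve. all: by end_near. Qed.

Lemma continuous_dweighted : continuous dweighted.
Proof.
have [f df cf] := C1_derive C1_weighted.
have -> : dweighted = f.
  by apply/funext => t; exact: is_derive_unique (is_derive_weighted t) (df t).
exact: C1_continuous (cf 0%N).
Qed.

(** For [f = t h] with [h' = k / (t^2 P)], the function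
[((1 - t^2) f'' - m t f' + m f) w = (P f')' + m w f] is [k' / t]. The terms in [h]
cancel because [t] is in the kernel of the operator. *)
Lemma self_adjoint_form (t : R) : 0 < t < 1 ->
  ((1 - t ^+ 2) * (2 * pw t + t * dweighted t) - m%:R * t ^+ 2 * pw t)
    * zonal_weight m.+1 t = k1 t / t.
Proof.
move=> t01; have /andP[t0 t1] := t01.
have s0 : 0 < 1 - t ^+ 2 by apply: onem_sqr_gt0; apply/andP; split; lra.
have wq : (1 - t ^+ 2) * ode_weight t * zonal_weight m.+1 t = t ^- 2.
  rewrite /ode_weight /zonal_weight powR_invn ?(ltW t0)//.
  rewrite mulrCA -!mulrA -powRD ?(gt_eqF s0) ?implybT//.
  have -> : - (m%:R / 2) + (m.+1%:R - 3) / 2 = - 1 :> R.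
    by rewrite -natr1; field.
  by rewrite powR_inv1 ?(ltW s0)// mulfV ?mulr1// gt_eqF.
transitivity (t * k1 t * ((1 - t ^+ 2) * ode_weight t * zonal_weight m.+1 t)).
  rewrite /pw /dweighted /dlog_ode_weight; field.
  by rewrite !gt_eqF.
by rewrite wq; field; rewrite gt_eqF.
Qed.

End test_function.

Hypotheses (m0 : (0 < m)%N) (hg : berg_function m.+1 g).

Lemma berg_test_self_adjoint : exists2 C : R, 0 <= C &
  forall (a b T : R) (h k k1 : R -> R), 0 < a -> b < 1 ->
  (forall j, C1 j [set: R] k) -> (forall t, ~~ (a <= t <= b) -> k t = 0) ->
  (forall t : R, is_derive t 1 k (k1 t)) ->
  (forall t : R, is_derive t 1 h (k t * ode_weight t)) ->
  (forall t, ~~ (a <= t <= b) -> h t = 0) -> (forall t, `|h t| <= T) ->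
  `|\int[leb]_(t in `[a, b]) (g t / t / m%:R * k1 t)| <= C * T.
Proof.
have [C C0 hC] := berg_test m0 hg; exists C => //.
move=> a b T h k k1 a0 b1 ck kout dk dh hout hT.
have dh1 := is_derive_weighted a0 b1 kout dk.
have := hC a b T h _ _ a0 b1 _ dh dh1 (continuous_dweighted a0 b1 ck kout dk) _ hT.
have -> : \int[leb]_(t in `[a, b]) (g t / t / m%:R * k1 t) =
    \int[leb]_(t in `[a, b]) (g t * (m%:R^-1 * ((1 - t ^+ 2) *
      (2 * (k t * ode_weight t) + t * dweighted k k1 t)
      - m%:R * t ^+ 2 * (k t * ode_weight t))) * zonal_weight m.+1 t).
  apply: eq_Rintegral => t; rewrite inE/= in_itv/= => /andP[ta tb].
  have t01 : 0 < t < 1 by rewrite (lt_le_trans a0 ta) (le_lt_trans tb b1).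
  have := self_adjoint_form k k1 t01; set N := (_ - _); move=> E.
  have -> : g t * (m%:R^-1 * N) * zonal_weight m.+1 t =
      g t * m%:R^-1 * (N * zonal_weight m.+1 t) by ring.
  by rewrite E; ring.
apply.
- case=> [|j]; first by split=> // t _; exact: is_derive_continuous dh t.
  exact: C1_primitive dh (C1_weighted a0 b1 ck kout j).
- move=> t tab; split; first exact: hout.
    by rewrite kout// mul0r.
  by rewrite /dweighted (is_derive_outside dk kout tab) kout// mul0r addr0 mul0r.
Qed.

Lemma weighted_primitive (a b : R) (k : R -> R) : 0 < a -> a <= b -> b < 1 ->
  (forall j, C1 j [set: R] k) -> (forall t, 0 <= k t) ->
  (forall t, t <= a -> k t = 0) -> (forall t, b <= t -> k t = 0) ->
  exists h : R -> R, [/\ forall t : R, is_derive t 1 h (k t * ode_weight t),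
    forall t, t <= a -> h t = 0, forall t, b <= t -> h t = h b &
    forall t, 0 <= h t <= h b].
Proof.
move=> a0 ab b1 ck k0 kl kr.
have kout t : ~~ (a <= t <= b) -> k t = 0.
  by rewrite negb_and -!ltNge => /orP[/ltW/kl|/ltW/kr].
have cp : continuous (fun t => k t * ode_weight t).
  exact: C1_continuous (C1_weighted a0 b1 ck kout 0%N).
have pl t : t <= a -> k t * ode_weight t = 0 by move=> /kl ->; rewrite mul0r.
have [h h0 dh] := primitive_exists cp pl.
have p0 t : 0 <= k t * ode_weight t by rewrite mulr_ge0// ode_weight_ge0.
have hmono := primitive_homo dh p0.
have hr t : b <= t -> h t = h b.
  by apply: (primitive_const dh) => u bu; rewrite kr// mul0r.
exists h; split=> // t; apply/andP; split.
  have [ta|/ltW at'] := leP t a; first by rewrite h0.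
  by rewrite -(h0 a (lexx _)); exact: hmono.
have [tb|/ltW bt] := leP t b; first exact: hmono.
by rewrite hr.
Qed.

Lemma berg_quotient_continuous (t : R) : 0 < t < 1 ->
  {for t, continuous (fun t : R => g t / t / m%:R)}.
Proof.
move=> /andP[t0 t1]; apply: continuousM; last exact: cst_continuous.
apply: continuousM; last by apply: continuousV; [rewrite gt_eqF|exact: cvg_id].
by apply: (berg_continuous hg); rewrite t1 (lt_trans _ t0)// ltrN10.
Qed.

(** The primitive [h] of [k / (t^2 P)] need not vanish near 1. Subtracting a
multiple of a fixed bump from [k] corrects this; the multiple is proportional to
[h(b)], which is also a bound for [|h|]. *)
Lemma balanced_test : exists2 C : R, 0 <= C & forall (t1 b : R) (k k' : R -> R),
  2^-1 <= t1 -> t1 <= b -> b < 1 -> (forall j, C1 j [set: R] k) ->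
  (forall t : R, is_derive t 1 k (k' t)) -> (forall t, 0 <= k t <= 1) ->
  (forall t, t <= t1 -> k t = 0) -> (forall t, b <= t -> k t = 0) ->
  `|\int[leb]_(t in `[4^-1, b]) (g t / t / m%:R * k' t)| <=
  C * ((b - t1) * (1 - b) `^ (- (m%:R / 2))).
Proof.
have [C C0 hC] := berg_test_self_adjoint.
pose a : R := 4^-1.
have a0 : 0 < a by rewrite invr_gt0.
have a2 : a < 2^-1 by rewrite /a; lra.
have h21 : 2^-1 < 1 :> R by lra.
pose kap : R -> R := sbump a 2^-1.
have ckap j : C1 j [set: R] kap by exact: C1_sbump.
have [kap' dkap ckap'] := C1_derive ckap.
have kap0 t : 0 <= kap t by exact: sbump_ge0.
have [hk [dhk hkl hkr hkb]] := weighted_primitive a0 (ltW a2) h21 ckap kap0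
  (@sbump_outl R a 2^-1) (@sbump_outr R a 2^-1).
have kapout t : ~~ (a <= t <= 2^-1) -> kap t = 0.
  rewrite negb_and -!ltNge => /orP[/ltW ta|/ltW at2]; first exact: sbump_outl.
  exact: sbump_outr.
pose Lam := hk 2^-1.
have Lam0 : 0 < Lam.
  rewrite /Lam -(hkl a (lexx _)); apply: (primitive_gt0 dhk) => //.
    by move=> t; rewrite mulr_ge0// ode_weight_ge0.
  move=> t /andP[ta tb].
  by rewrite mulr_gt0 ?sbump_gt0 ?ta// ode_weight_gt0// (lt_trans a0 ta) (lt_trans tb h21).
pose G (t : R) : R := g t / t / m%:R.
pose K0 := \int[leb]_(t in `[a, 2^-1]) (G t * kap' t).
exists (4 * (C + `|K0| / Lam)).
  by rewrite mulr_ge0// addr_ge0// divr_ge0// ltW.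
move=> t1 b k k' t1h t1b b1 ck dk k01 kl kr.
have t10 : 0 < t1 by exact: lt_le_trans t1h.
have k0 t : 0 <= k t by have /andP[] := k01 t.
have at1 : a < t1 by exact: lt_le_trans t1h.
have ab : a < b by exact: lt_le_trans t1b.
have [h [dh hl hr hb]] := weighted_primitive t10 t1b b1 ck k0 kl kr.
set W := (1 - b) `^ _.
pose T := h b.
have TW : T <= 4 * ((b - t1) * W).
  have [c /andP[c1 c2]] := mean_value dh t1b.
  rewrite (hl t1 (lexx _)) subr0 -/T => ->.
  rewrite [leRHS]mulrCA [leLHS]mulrC; apply: ler_wpM2l; first by rewrite subr_ge0.
  have /andP[kc0 kc1] := k01 c.
  rewrite -[leRHS]mul1r; apply: ler_pM => //; first exact: ode_weight_ge0.
  by apply: ode_weight_le => //; exact: le_trans t1h c1.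
have T0 : 0 <= T by have /andP[] := hb b.
(* With this factor, [h - lam * hk] vanishes from [b] on. *)
pose lam := T / Lam.
have lam0 : 0 <= lam by rewrite divr_ge0// ltW.
have lamL : lam * Lam = T by rewrite divfK// gt_eqF.
have dkl := is_derive_subZ lam dk dkap.
have ckl j : C1 j [set: R] (fun t => k t - lam * kap t).
  exact: C1_subZ (ck j) (ckap j).
have dhl (t : R) : is_derive t 1 (fun t => h t - lam * hk t)
    ((k t - lam * kap t) * ode_weight t).
  by apply: (is_derive_eq (is_derive_subZ lam dh dhk t)); ring.
have klout t : ~~ (a <= t <= b) -> k t - lam * kap t = 0.
  rewrite negb_and -!ltNge => /orP[ta|bt].
    by rewrite kl ?(ltW (lt_trans ta at1))// /kap sbump_outl ?(ltW ta)// mulr0 subr0.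
  rewrite kr ?(ltW bt)// /kap sbump_outr ?mulr0 ?subr0//.
  exact: le_trans (le_trans t1h t1b) (ltW bt).
have hlout t : ~~ (a <= t <= b) -> h t - lam * hk t = 0.
  rewrite negb_and -!ltNge => /orP[ta|bt].
    by rewrite hl ?(ltW (lt_trans ta at1))// hkl ?(ltW ta)// mulr0 subr0.
  rewrite hr ?(ltW bt)// hkr ?lamL ?subrr//.
  exact: le_trans (le_trans t1h t1b) (ltW bt).
have hT t : `|h t - lam * hk t| <= T.
  have /andP[x1 x2] := hb t; have /andP[y1 y2] := hkb t.
  have z1 : 0 <= lam * hk t by rewrite mulr_ge0.
  have z2 : lam * hk t <= T by rewrite -lamL ler_wpM2l.
  rewrite ler_norml; apply/andP; split.
    by rewrite lerBrDl (le_trans _ x1)// subr_le0.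
  by rewrite lerBlDl (le_trans x2)// lerDr.
have := hC a b T _ _ _ a0 b1 ckl klout dkl dhl hlout hT.
have iG (f : R -> R) : continuous f -> leb.-integrable `[a, b] (EFin \o (fun t => G t * f t)).
  move=> cf; apply: segment_integrable => t /andP[ta tb].
  apply: continuousM; last exact: cf.
  by apply: berg_quotient_continuous; rewrite (lt_le_trans a0 ta) (le_lt_trans tb b1).
have mI : measurable (`[a, b]%classic : set (measurableTypeR R)) by exact: measurable_itv.
have ck' : continuous k'.
  have [k1 dk1 ck1] := C1_derive ck.
  have -> : k' = k1 by apply/funext => t; exact: is_derive_unique (dk t) (dk1 t).
  exact: C1_continuous (ck1 0%N).
have ik' := iG _ ck'; have ikap := iG _ (C1_continuous (ckap' 0%N)).
have -> : \int[leb]_(t in `[a, b]) (g t / t / m%:R * (k' t - lam * kap' t)) =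
    \int[leb]_(t in `[a, b]) (G t * k' t) - lam * \int[leb]_(t in `[a, b]) (G t * kap' t).
  rewrite -RintegralZl// -RintegralB//.
  - by apply: eq_Rintegral => t _; rewrite -/(G t); ring.
  - by have := @integrableZl _ _ _ leb _ mI lam _ ikap.
have -> : \int[leb]_(t in `[a, b]) (G t * kap' t) = K0.
  rewrite /K0 Rintegral_mkcond [RHS]Rintegral_mkcond; congr Rintegral.
  apply/funext => t; rewrite /patch !mem_setE !in_itv/=.
  have [/andP[ta tb]|tab] := boolP (a <= t <= 2^-1).
    by rewrite ta (le_trans tb)// (le_trans t1h).
  by rewrite (is_derive_outside dkap kapout tab) mulr0; case: ifP.
move=> A3; rewrite -[X in `|X|](subrK (lam * K0)).
apply: le_trans (ler_normD _ _) _; apply: le_trans (lerD A3 (lexx _)) _.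
rewrite normrM (ger0_norm lam0) /lam.
have -> : C * T + T / Lam * `|K0| = (C + `|K0| / Lam) * T by ring.
rewrite [4 * _]mulrC -mulrA ler_wpM2l// addr_ge0// divr_ge0//; exact: ltW.
Qed.

(** For [k] the difference of two unit steps at [t1] and [t2], [k'] averages
[g(t) / t] near [t1] and, with the opposite sign, near [t2]. *)
Lemma berg_growth : exists2 M : R, 0 <= M & forall t1 t2 b : R,
  2^-1 <= t1 -> t1 < t2 -> t2 < b -> b < 1 ->
  `|g t1 / t1 - g t2 / t2| <= M * ((b - t1) * (1 - b) `^ (- (m%:R / 2))).
Proof.
have [C C0 hC] := balanced_test.
have mR : 0 < m%:R :> R by rewrite ltr0n.
exists (m%:R * C); first by rewrite mulr_ge0.
move=> t1 t2 b t1h t12 t2b b1.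
pose G (t : R) : R := g t / t / m%:R.
have GE t : g t / t = m%:R * G t by rewrite /G [RHS]mulrC divfK// gt_eqF.
rewrite !GE -mulrBr normrM ger0_norm// -mulrA ler_pM2l//.
have a0 : 0 < 4^-1 :> R by rewrite invr_gt0.
have at1 : 4^-1 < t1 by apply: lt_le_trans t1h; lra.
have cG t : 4^-1 <= t <= b -> {for t, continuous G}.
  move=> /andP[ta tb]; apply: berg_quotient_continuous.
  by rewrite (lt_le_trans a0 ta) (le_lt_trans tb b1).
apply/ler_addgt0Pr => eta eta0.
have eta2 : 0 < eta / 2 by rewrite divr_gt0.
have near_avg (t : R) : 4^-1 <= t <= b -> exists2 e, 0 < e &
    forall x, t <= x <= t + e -> `|G x - G t| <= eta / 2.
  move=> /cG; rewrite /prop_for /continuous_at => /cvgrPdist_le/(_ _ eta2).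
  move=> /nbhs_ballP[e /= e0 He]; exists (e / 2) => [|x /andP[tx xe]].
    by rewrite divr_gt0.
  rewrite distrC; apply: He; rewrite /ball/= distrC ger0_norm ?subr_ge0//.
  by rewrite ltrBlDl; apply: (le_lt_trans xe); rewrite ltrD2l ltr_pdivrMr// ltr_pMr// ltr1n.
have t1b : t1 < b := lt_trans t12 t2b.
have at2 : 4^-1 < t2 := lt_trans at1 t12.
have t1ab : 4^-1 <= t1 <= b by rewrite (ltW at1) (ltW t1b).
have t2ab : 4^-1 <= t2 <= b by rewrite (ltW at2) (ltW t2b).
have [e1 e10 He1] := near_avg _ t1ab.
have [e2 e20 He2] := near_avg _ t2ab.
pose eps := Num.min (Num.min e1 e2) (Num.min (t2 - t1) (b - t2)).
have eps0 : 0 < eps by rewrite !lt_min e10 e20/= !subr_gt0 t12.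
have [eps1 eps2] : eps <= e1 /\ eps <= e2 by split; rewrite !ge_min lexx ?orbT.
have d1t2 : t1 + eps <= t2 by rewrite -lerBrDl !ge_min lexx !orbT.
have d2b : t2 + eps <= b by rewrite -lerBrDl !ge_min lexx !orbT.
have [|psi1 [F1 M1]] := @mollifier_exists R t1 (t1 + eps); first by rewrite ltrDl.
have [|psi2 [F2 M2]] := @mollifier_exists R t2 (t2 + eps); first by rewrite ltrDl.
have [cpsi1 _ _ dF1 [F1l F1r F1b]] := M1.
have [cpsi2 _ _ dF2 [F2l F2r F2b]] := M2.
have := hC t1 b (fun t => F1 t - 1 * F2 t) _ t1h (ltW t1b) b1 _ (is_derive_subZ 1 dF1 dF2).
set I := \int[leb]_(t in _) _ => A3.
have {}A3 : `|I| <= C * ((b - t1) * (1 - b) `^ (- (m%:R / 2))).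
  apply: A3.
  - move=> j; apply: C1_subZ; first exact: C1_of_derive dF1 cpsi1 j.
    exact: C1_of_derive dF2 cpsi2 j.
  - move=> t; rewrite mul1r; have /andP[x1 x2] := F1b t; have /andP[y1 y2] := F2b t.
    rewrite subr_ge0 lerBlDr (le_trans x2) ?lerDl// andbT.
    have [tt2|/ltW t2t] := leP t t2; first by rewrite F2l.
    by rewrite (F1r t)// (le_trans d1t2).
  - by move=> t tt1; rewrite F1l// F2l ?mulr0 ?subr0// (le_trans tt1)// ltW.
  - move=> t bt; rewrite F2r ?(le_trans d2b)// F1r ?mulr1 ?subrr//.
    by apply: le_trans d1t2 (le_trans (ltW t2b) bt).
have iG (f : R -> R) : continuous f -> leb.-integrable `[4^-1, b] (EFin \o (fun t => G t * f t)).
  move=> cf; apply: segment_integrable => t /cG tc.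
  by apply: continuousM; [exact: tc|exact: cf].
have mI : measurable (`[4^-1, b]%classic : set (measurableTypeR R)) by exact: measurable_itv.
have i1 := iG _ (C1_continuous (cpsi1 0%N)); have i2 := iG _ (C1_continuous (cpsi2 0%N)).
pose I1 := \int[leb]_(t in `[4^-1, b]) (G t * psi1 t).
pose I2 := \int[leb]_(t in `[4^-1, b]) (G t * psi2 t).
have IE : I = I1 - I2.
  rewrite /I /I1 /I2 -RintegralB//.
  by apply: eq_Rintegral => t _; rewrite -/(G t); ring.
have ab : 4^-1 < b := lt_trans at1 t1b.
have A1 : `|I1 - G t1| <= eta / 2.
  apply: (mollifier_average ab (ltW at1) (le_trans d1t2 (ltW t2b)) M1 cG) => t /andP[x1 x2].
  by apply: He1; rewrite x1 (le_trans x2)// lerD2l.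
have A2 : `|I2 - G t2| <= eta / 2.
  apply: (mollifier_average ab (ltW at2) d2b M2 cG) => t /andP[x1 x2].
  by apply: He2; rewrite x1 (le_trans x2)// lerD2l.
have -> : G t1 - G t2 = I - (I1 - G t1) + (I2 - G t2) by rewrite IE; ring.
apply: le_trans (ler_normD _ _) _.
apply: le_trans (lerD (ler_normB _ _) (lexx _)) _.
by rewrite -addrA [eta]splitr; apply: lerD => //; exact: lerD.
Qed.

End weighted_profiles.

(** * The metric projection *)

Section metric_projection.
Context {R : realType} {n : nat}.
Implicit Types (x y z : 'rV[R]_n) (K : set 'rV[R]_n).

Lemma continuous_dot_self : continuous (fun x : 'rV[R]_n => dot x x).
Proof.
suff [c _] : Cdir (fun _ : unit => 0) 0 [set: 'rV[R]_n] (fun x => dot x x).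
  by move=> x; exact: c.
apply: Cdir_sum; first exact: openT.
by move=> i; apply: Cdir_mul; [exact: openT| |];
  split=> // x _; exact: coord_continuous.
Qed.

Lemma continuous_enorm : continuous (@enorm R n).
Proof.
move=> x; apply: (@continuous_comp _ _ _ (fun x : 'rV[R]_n => dot x x) Num.sqrt).
  exact: continuous_dot_self.
exact: sqrt_continuous.
Qed.

Lemma lipschitz_continuous (f : 'rV[R]_n -> R) :
  (forall x y, `|f x - f y| <= enorm (x - y)) -> continuous f.
Proof.
move=> Lf x; apply/(@cvgrPdist_le _ R^o _ (nbhs x) (nbhs_filter x)) => eps eps0.
have : (fun y => enorm (x - y)) @ x --> enorm (x - x).
  apply: (@continuous_comp _ _ _ (fun y : 'rV[R]_n => x - y) (@enorm R n)); last exact: continuous_enorm.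
  by apply: continuousB; [exact: cst_continuous|move=> A].
rewrite subrr enorm0 => /cvgr0Pnorm_le/(_ _ eps0).
apply: filterS => y; rewrite ger0_norm ?enorm_ge0// => H.
exact: le_trans (Lf x y) H.
Qed.

Lemma continuous_measurable_rV (f : 'rV[R]_n -> R) :
  continuous f -> measurable_fun setT f.
Proof.
move=> cf; apply: (measurability _ (RGenOpens.measurableE R)) => _ [_ [a [b ->]] <-].
apply: sub_sigma_algebra; rewrite setTI.
by move/continuousP : cf; apply; exact: interval_open.
Qed.

Definition nearest K x p := K p /\ forall q, K q -> enorm (x - p) <= enorm (x - q).

Variable K : set 'rV[R]_n.
Hypothesis hK : convex_body K.

Lemma nearest_exists x : exists p, nearest K x p.
Proof.
have [K0 cK _] := hK.
have cf : {within K, continuous (fun q => enorm (x - q))}.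
  apply: continuous_subspaceT => y.
  apply: (@continuous_comp _ _ _ (fun y : 'rV[R]_n => x - y) (@enorm R n)); last exact: continuous_enorm.
  by apply: continuousB; [exact: cst_continuous|move=> A].
have [p Kp minp] := compact_EVT_min K0 cK cf.
exists p; split; first exact: set_mem.
by move=> q Kq; apply: minp; rewrite inE.
Qed.

Lemma metric_projP x : nearest K x (metric_proj K x).
Proof. exact: (@xgetPex _ 0 _ (nearest_exists x)). Qed.

(** Moving from [p] towards [q] inside [K] by a small step [t] would decrease the
distance to [x] to first order in [t]. *)
Lemma nearest_variational x p q : nearest K x p -> K q -> dot (x - p) (q - p) <= 0.
Proof.
move=> [Kp minp] Kq; have [_ _ cvK] := hK.
have [u Eu] : exists u, u = x - p by exists (x - p).
have [v Ev] : exists v, v = q - p by exists (q - p).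
rewrite -Eu -Ev.
rewrite leNgt; apply/negP => d0.
have e0 : 0 <= dot v v by exact: dot_ge0.
have [t [t0 t1 td]] : exists t, [/\ 0 < t, t <= 1 & t * (dot v v + 1) <= dot u v].
  have e1 : 0 < dot v v + 1 by rewrite ltr_wpDl.
  exists (Num.min 1 (dot u v / (dot v v + 1))); split.
  - by rewrite lt_min ltr01 divr_gt0.
  - by rewrite ge_min lexx.
  - by rewrite -ler_pdivlMr// ge_min lexx orbT.
have Kt : K (p + t *: v).
  have : K (t *: q + (1 - t) *: p).
    have := cvK q p (Itv01 (ltW t0) t1) (mem_set Kq) (mem_set Kp).
    by rewrite inE.
  by congr K; rewrite Ev; apply/matrixP => i j; rewrite !mxE; ring.
have := minp _ Kt; rewrite -(@ler_pXn2r _ 2) ?nnegrE ?enorm_ge0// !sqr_enorm.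
rewrite opprD addrA -Eu dotDl !dotDr !dotNl !dotNr !dotZl !dotZr (dotC v u).
move: (dot u v) (dot v v) (dot u u) d0 e0 td => d e c d0 e0 td H.
have : t * (2 * d) <= t * (t * e) by nra.
rewrite ler_pM2l//; nra.
Qed.

Lemma metric_proj_lipschitz x y :
  enorm (metric_proj K x - metric_proj K y) <= enorm (x - y).
Proof.
set p := metric_proj K x; set q := metric_proj K y.
have Px : nearest K x p := metric_projP x.
have Qy : nearest K y q := metric_projP y.
have H1 := nearest_variational Px Qy.1.
have H2 := nearest_variational Qy Px.1.
have [pq|pq] := eqVneq p q; first by rewrite pq subrr enorm0 enorm_ge0.
have n0 : 0 < enorm (p - q) by rewrite sqrtr_gt0 dot_gt0// subr_eq0.
rewrite -(ler_pM2r n0); apply: le_trans (cauchy_schwarz _ _).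
rewrite -expr2 sqr_enorm.
move: H1 H2; rewrite !(dotDl, dotDr, dotNl, dotNr) (dotC q p).
lra.
Qed.

Lemma edistE x : Defs.edist x K = enorm (x - metric_proj K x).
Proof.
have [Kp minp] := metric_projP x.
apply/eqP; rewrite eq_le; apply/andP; split.
  apply: ge_inf; last by exists (metric_proj K x).
  by exists 0 => _ [q _ <-]; exact: enorm_ge0.
apply: lb_le_inf; first by exists (enorm (x - metric_proj K x)), (metric_proj K x).
by move=> _ [q Kq <-]; exact: minp.
Qed.

Lemma measurable_metric_proj : measurable_fun setT (metric_proj K).
Proof.
apply: measurable_fun_rV => i; apply: continuous_measurable_rV.
apply: lipschitz_continuous => x y; apply: le_trans (metric_proj_lipschitz x y).
by rewrite -[X in `|X|](_ : (metric_proj K x - metric_proj K y) ord0 i = _) ?coord_le_enorm// !mxE.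
Qed.

End metric_projection.

(** * Area measures of caps *)

Section area_bounds.
Context {R : realType} {n : nat}.
Implicit Types (x : 'rV[R]_n) (w : set 'rV[R]_n).
Variable K : set 'rV[R]_n.
Hypothesis hK : convex_body K.

Lemma measurable_local_parallel_set (rho : R) w : measurable w ->
  measurable (local_parallel_set K rho w).
Proof.
move=> mw; have [_ cK _] := hK.
have mp := measurable_metric_proj hK.
have md : measurable_fun setT (fun x => x - metric_proj K x).
  apply: measurable_fun_rV => i; under eq_fun do rewrite !mxE.
  apply: measurable_funB; first exact: measurable_coord.
  exact: (measurableT_comp (measurable_coord i) mp).
rewrite (_ : local_parallel_set K rho w = ~` K `&`
    ((fun x => enorm (x - metric_proj K x)) @^-1` `]-oo, rho]%classic `&`
     (fun x => direction (x - metric_proj K x)) @^-1` w)); last first.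
  apply/seteqP; split=> x; rewrite /local_parallel_set /= (edistE hK) in_itv/=.
    by case.
  by case=> nK [H1 H2]; split.
apply: measurableI.
  apply: sub_sigma_algebra; rewrite openC; apply: compact_closed; last exact: cK.
  exact: (@norm_hausdorff _ 'rV[R]_n).
apply: measurableI; rewrite -[X in measurable X]setTI.
  by apply: (measurableT_comp measurable_enorm md).
by apply: (measurableT_comp measurable_direction md).
Qed.

Lemma convex_body_bounded : exists2 D : R, 0 <= D & forall x, K x -> enorm x <= D.
Proof.
have [K0 cK _] := hK.
have cf : {within K, continuous (@enorm R n)}.
  by apply: continuous_subspaceT; exact: continuous_enorm.
have [p Kp maxp] := compact_EVT_max K0 cK cf.
by exists (enorm p) => [|x Kx]; [exact: enorm_ge0|apply: maxp; rewrite inE].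
Qed.

Variable S : nat -> {measure set 'rV[R]_n -> \bar R}.
Hypothesis hS : area_measures K S.

(** Each term of the Steiner polynomial is at most its value, the volume of the
local parallel set. *)
Lemma area_le_box (rho : R) w (a : 'I_n -> R) j : (j < n)%N -> 0 < rho ->
  measurable w -> w `<=` sphere n -> (forall i, 0 <= a i) ->
  local_parallel_set K rho w `<=` box a ->
  (S j w <= (n%:R * (\prod_i (2 * a i)) / rho ^+ (n - j))%:E)%E.
Proof.
move=> jn rho0 mw ws a0 Wa.
have n0 : 0 < n%:R :> R by rewrite ltr0n (leq_ltn_trans _ jn).
have : (lebesgue_rV R n (local_parallel_set K rho w) <= lebesgue_rV R n (box a))%E.
  apply: le_measure => //; rewrite inE; last exact: measurable_box.
  exact: measurable_local_parallel_set.
rewrite lebesgue_box// hS.2// => H.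
pose T (i : 'I_n) : \bar R := ((rho ^+ (n - i) * 'C(n, i)%:R)%:E * S i w)%E.
have T0 i : (0 <= T i)%E.
  by rewrite mule_ge0// lee_fin mulr_ge0// exprn_ge0// ltW.
have Tj : ((rho ^+ (n - j))%:E * S j w <= \sum_(i < n) T i)%E.
  rewrite (bigD1 (Ordinal jn))//=; apply: (@le_trans _ _ (T (Ordinal jn))).
    rewrite /T /=; apply: lee_wpmul2r => //.
    rewrite lee_fin ler_peMr ?exprn_ge0 ?(ltW rho0)// ler1n bin_gt0.
    exact: ltnW.
  by rewrite leeDl// sume_ge0.
have r0 : 0 < rho ^+ (n - j) by rewrite exprn_gt0.
rewrite mulrC EFinM lee_pdivlMl//; apply: (le_trans Tj).
by rewrite EFinM -lee_pdivrMl.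
Qed.

Lemma area_fin j : (j < n)%N -> (S j (sphere n) < +oo)%E.
Proof.
move=> jn; have [D D0 KD] := convex_body_bounded.
apply: (@le_lt_trans _ _ (n%:R * (\prod_(i < n) (2 * (D + 1))) / 1 ^+ (n - j))%:E).
  apply: area_le_box => //; first exact: measurable_sphere.
    by move=> i; rewrite addr_ge0.
  move=> x [_ xK _] i; move: xK; rewrite (edistE hK) => xK.
  have [Kp _] := metric_projP hK x.
  have -> : x ord0 i = (x - metric_proj K x) ord0 i + metric_proj K x ord0 i.
    by rewrite !mxE subrK.
  apply: le_trans (ler_normD _ _) _; rewrite addrC lerD//.
    exact: le_trans (coord_le_enorm _ _) (KD _ Kp).
  exact: le_trans (coord_le_enorm _ _) xK.
by rewrite ltry.
Qed.

End area_bounds.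

Definition cap {R : realType} n (s : R) : set 'rV[R]_n :=
  [set v | sphere n v /\ s < dot v (e_last n)].
Arguments cap {R} n s.

Lemma measurable_cap {R : realType} n (s : R) : measurable (cap n s).
Proof.
rewrite (_ : cap n s = sphere n `&` (dot ^~ (e_last n)) @^-1` `]s, +oo[%classic); last first.
  by apply/seteqP; split=> v; rewrite /cap /= in_itv/= andbT.
apply: measurableI; first exact: measurable_sphere.
by rewrite -[X in measurable X]setTI; exact: measurable_dot.
Qed.

(** The unit vectors of this cap have all coordinates but the last at most
[2 / 2^i]. So the parallel set of radius [2^i] over it extends [K] by at most 2
in all directions but the last, where it extends [K] by at most [2^i]. *)
Lemma area_cap_le {R : realType} n (K : set 'rV[R]_n.+1) (hK : convex_body K)
    (S : nat -> {measure set 'rV[R]_n.+1 -> \bar R}) (hS : area_measures K S) :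
  exists2 V : R, 0 <= V & forall i j, (j < n.+1)%N ->
    (S j (cap n.+1 (1 - 4^-1 ^+ i)) <= (V * 2 ^+ i / (2 ^+ i) ^+ (n.+1 - j))%:E)%E.
Proof.
have [D D0 KD] := convex_body_bounded hK.
pose A : R := \prod_(k < n.+1) (2 * (D + 2)).
have A0 : 0 <= A by apply: prodr_ge0 => k _; lra.
exists (n.+1%:R * A); first by rewrite mulr_ge0.
move=> i j jn.
pose P : R := 2 ^+ i.
have P1 : 1 <= P by rewrite exprn_ege1// ler1n.
pose a (k : 'I_n.+1) : R := if k == ord_max then D + P else D + 2.
have Pi : 4^-1 ^+ i = (P ^+ 2)^-1 :> R.
  by rewrite exprVn /P [in RHS]exprAC -[2 ^+ 2]natrX.
have P0 : 0 < P by exact: lt_le_trans P1.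
have cs : cap n.+1 (1 - 4^-1 ^+ i : R) `<=` sphere n.+1 by move=> v [].
have H := area_le_box hK hS (a := a) jn P0 (@measurable_cap R n.+1 (1 - 4^-1 ^+ i)) cs.
apply: le_trans (H _ _) _ => {H}.
- by move=> k; rewrite /a; case: ifP => _; lra.
- move=> x [_ xK [us uc]] k; move: xK; rewrite (edistE hK) => xK.
  set p := metric_proj K x in us uc xK *.
  have [Kp _] := metric_projP hK x; rewrite -/p in Kp.
  set u := direction (x - p) in us uc.
  have xE : x = p + enorm (x - p) *: u.
    rewrite /u /direction scalerA.
    have [z|nz] := eqVneq (enorm (x - p)) 0.
      by move: us; rewrite /u /direction z invr0 scale0r /sphere /= enorm0 => /eqP; rewrite eq_sym oner_eq0.
    by rewrite divff// scale1r addrC subrK.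
  clearbody u.
  have pk : `|p ord0 k| <= D by exact: le_trans (coord_le_enorm _ _) (KD _ Kp).
  rewrite xE !mxE; apply: le_trans (ler_normD _ _) _.
  rewrite normrM (ger0_norm (enorm_ge0 _)) /a.
  case: eqVneq => [->|km].
    rewrite lerD ?(le_trans (coord_le_enorm _ _) (KD _ Kp))//.
    rewrite -[leRHS]mulr1; apply: ler_pM => //; first exact: enorm_ge0.
    exact: sphere_coord_le1.
  rewrite lerD//.
  apply: (@le_trans _ _ (P * `|u ord0 k|)); first by rewrite ler_wpM2r.
  move: uc; rewrite dot_e_last Pi => uc.
  have um : `|u ord0 ord_max| <= 1 by exact: sphere_coord_le1.
  have u2 : u ord0 k ^+ 2 + u ord0 ord_max ^+ 2 <= 1.
    have : dot u u = 1 by rewrite -sqr_enorm us expr1n.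
    rewrite /dot (bigD1 k)//= (bigD1 ord_max)/= 1?eq_sym// => <-.
    rewrite -!expr2 addrA lerDl; apply: sumr_ge0 => l _.
    by rewrite -expr2 sqr_ge0.
  have s0 : 0 <= 1 - (P ^+ 2)^-1.
    rewrite subr_ge0 invf_le1; first exact: exprn_ege1.
    exact: exprn_gt0.
  (* [u_k^2 <= 1 - (1 - 4^-i)^2 <= 2 * 4^-i]. *)
  have uk2 : `|u ord0 k| ^+ 2 <= 2 * (P ^+ 2)^-1.
    rewrite real_normK ?num_real//; nra.
  rewrite -(@ler_pXn2r _ 2) ?nnegrE ?mulr_ge0//; last by lra.
  rewrite exprMn; have P20 : 0 < P ^+ 2 by rewrite exprn_gt0//; lra.
  have : P ^+ 2 * `|u ord0 k| ^+ 2 <= P ^+ 2 * (2 * (P ^+ 2)^-1) by rewrite ler_pM2l.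
  have -> : P ^+ 2 * (2 * (P ^+ 2)^-1) = 2 by field; rewrite gt_eqF.
  by move=> H; apply: (le_trans H); nra.
rewrite lee_fin ler_pM2r ?invr_gt0 ?exprn_gt0//.
rewrite -mulrA ler_pM2l ?ltr0n// /A.
rewrite (bigD1 ord_max)//= [X in _ <= X * _](bigD1 ord_max)//= /a eqxx.
rewrite (eq_bigr (fun=> 2 * (D + 2))); last by move=> k /negPf ->.
rewrite -[leRHS]mulrA [_ * P]mulrC mulrA ler_wpM2r//.
  by apply: prodr_ge0 => k _; lra.
by rewrite -/P; nra.
Qed.

(** * Integrability *)

Section dyadic.
Context {R : realType}.
Variables (m : nat) (g : R -> R).
Hypotheses (m0 : (0 < m)%N) (hg : berg_function m.+1 g).

(** The cap of the heights above [dyadic i] has angular radius of order [2^-i]. *)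
Definition dyadic (i : nat) : R := 1 - 4^-1 ^+ i.

Lemma dyadic_lt i j : (i < j)%N -> dyadic i < dyadic j.
Proof.
by move=> ij; rewrite /dyadic ltrD2l ltrN2 ltr_iXn2l//; lra.
Qed.

Lemma dyadic_lt1 i : dyadic i < 1.
Proof. by rewrite /dyadic gtrBl exprn_gt0//; lra. Qed.

Lemma dyadic_powR i : (1 - dyadic i) `^ (- (m%:R / 2)) = (2 ^+ i) ^+ m.
Proof.
rewrite /dyadic opprB addrC subrK.
have -> : 4^-1 ^+ i = (2 ^+ i)^-1 `^ 2 :> R.
  rewrite powR_mulrn ?invr_ge0 ?exprn_ge0// -exprVn [in RHS]exprAC.
  by congr (_ ^+ i); field.
rewrite -powRrM.
have -> : 2 * - (m%:R / 2) = - m%:R :> R by field.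
by rewrite powR_invn ?invr_ge0 ?exprn_ge0// exprVn invrK.
Qed.

(** The growth estimate with [b = dyadic i.+2], so that [t] may exceed
[dyadic i.+1]. *)
Lemma dyadic_growth : exists2 c : R, 0 <= c & forall i t, (0 < i)%N ->
  dyadic i < t -> t < dyadic i.+2 ->
  `|g (dyadic i) / dyadic i - g t / t| <= c * (4^-1 ^+ i * (2 ^+ i) ^+ m).
Proof.
have [M M0 hM] := berg_growth m0 hg.
exists (M * 4 ^+ m); first by rewrite mulr_ge0// exprn_ge0.
move=> i t i0 it ti.
have i2 : 2^-1 <= dyadic i.
  apply: (@le_trans _ _ (dyadic 1)); first by rewrite /dyadic expr1; lra.
  move: i0; rewrite leq_eqVlt => /orP[/eqP <-//|/dyadic_lt/ltW//].
apply: le_trans (hM _ _ _ i2 it ti (dyadic_lt1 _)) _.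
rewrite dyadic_powR -mulrA ler_wpM2l//.
have -> : (2 ^+ i.+2) ^+ m = 4 ^+ m * (2 ^+ i) ^+ m :> R.
  by rewrite -exprMn; congr (_ ^+ m); rewrite !exprS; ring.
rewrite mulrCA ler_wpM2l ?exprn_ge0// ler_wpM2r ?exprn_ge0//.
rewrite /dyadic; have : 0 <= 4^-1 ^+ i.+2 :> R by rewrite exprn_ge0//; lra.
lra.
Qed.

Lemma dyadic_exceeds (t : R) : t < 1 -> exists k, t < dyadic k.+2.
Proof.
move=> t1; have e0 : 0 < 1 - t by rewrite subr_gt0.
have [k kP] : exists k : nat, (1 - t)^-1 < 2 ^+ k.
  by exists (Num.bound (1 - t)^-1); exact: upper_nthrootP.
exists k; rewrite /dyadic ltrBrDl -ltrBrDr.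
have p0 : 0 < 2 ^+ k :> R by rewrite exprn_gt0.
have h1 : (2 ^+ k)^-1 < 1 - t :> R by rewrite -[ltRHS]invrK ltf_pV2 ?posrE ?invr_gt0.
apply: le_lt_trans h1; rewrite -exprVn.
apply: (@le_trans _ _ (4^-1 ^+ k)); last by rewrite lerXn2r ?nnegrE//; lra.
rewrite !exprS; set y : R := 4^-1 ^+ k.
have y0 : 0 <= y by rewrite exprn_ge0// invr_ge0.
by lra.
Qed.

(** A chain of points [dyadic i] leads from [dyadic 1] to [t], with one step per
scale. *)
Lemma berg_telescope : exists2 c : R, 0 <= c & forall k t,
  dyadic 1 <= t -> t < dyadic k.+2 ->
  `|g t / t| <= `|g (dyadic 1) / dyadic 1|
    + \sum_(i < k.+2) (dyadic i < t)%R%:R * (c * (4^-1 ^+ i * (2 ^+ i) ^+ m)).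
Proof.
have [c c0 hc] := dyadic_growth; exists c => //.
pose a i : R := c * (4^-1 ^+ i * (2 ^+ i) ^+ m).
have a0 i : 0 <= a i by rewrite mulr_ge0// mulr_ge0// exprn_ge0//; lra.
have ta0 (b : bool) i : 0 <= b%:R * (c * (4^-1 ^+ i * (2 ^+ i) ^+ m)).
  exact: mulr_ge0 (ler0n _ _) (a0 i).
have step i t x : (0 < i)%N -> dyadic i < t -> t < dyadic i.+2 ->
    `|g (dyadic i) / dyadic i| <= x -> `|g t / t| <= x + a i.
  move=> i0 it ti H; have H2 := hc i t i0 it ti.
  have -> : g t / t = g (dyadic i) / dyadic i - (g (dyadic i) / dyadic i - g t / t) by ring.
  by apply: le_trans (ler_normB _ _) _; rewrite lerD.
elim=> [|k IH] t t1 tk.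
  move: t1; rewrite le_eqVlt => /orP[/eqP <-|t1].
    by rewrite lerDl; apply: sumr_ge0 => i _; exact: ta0.
  apply: le_trans (step 1%N t _ _ t1 _ (lexx _)) _ => //.
    exact: lt_trans tk (dyadic_lt _).
  rewrite lerD2l !big_ord_recr/= big_ord0 add0r t1 [X in _ + X]mul1r /a lerDr.
  exact: ta0.
have [tk2|tk2] := ltP t (dyadic k.+2).
  apply: le_trans (IH t t1 tk2) _; rewrite lerD2l [leRHS]big_ord_recr/= lerDl.
  exact: ta0.
have k1t : dyadic k.+1 < t by apply: lt_le_trans tk2; exact: dyadic_lt.
have k11 : dyadic 1 <= dyadic k.+1.
  by case: (k) => // k'; exact/ltW/dyadic_lt.
apply: le_trans (step k.+1 t _ isT k1t tk (IH _ k11 (dyadic_lt (ltnSn _)))) _.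
rewrite -addrA lerD2l [X in X + _]big_ord_recr/= ltxx mul0r addr0.
rewrite [leRHS]big_ord_recr/= [X in _ <= X + _]big_ord_recr/= k1t [X in _ <= _ + X + _]mul1r.
rewrite -addrA lerD//.
  apply: ler_sum => i _; rewrite ler_wpM2r//; first exact: a0.
  have [it|//] := boolP (dyadic i < dyadic k.+1).
  by rewrite (lt_trans it k1t).
by rewrite lerDl; exact: ta0.
Qed.

(** A bound by a series of indicators of caps, which can be integrated term by
term. *)
Lemma berg_pointwise : exists B c : R, [/\ 0 <= B, 0 <= c & forall t,
  -1 <= t <= 1 -> (`|g t|%:E <= B%:E +
    \sum_(i <oo) ((dyadic i < t)%R%:R * (c * (4^-1 ^+ i * (2 ^+ i) ^+ m)))%:E)%E].
Proof.
have [c c0 hc] := berg_telescope.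
have [cg _ _ _] := hg.
have d1 : dyadic 1 = 3 / 4 by rewrite /dyadic expr1; field.
have cg' : {within `[-1, dyadic 1], continuous g}.
  apply: continuous_subspaceW cg => x /=; rewrite !in_itv/= => /andP[-> x2] /=.
  by apply: le_lt_trans x2 (dyadic_lt1 _).
have m1d : -1 <= dyadic 1 by rewrite d1; lra.
have [p _ pmax] := EVT_max m1d cg'; have [q _ qmin] := EVT_min m1d cg'.
pose B := `|g p| + `|g q| + `|g (dyadic 1) / dyadic 1| + `|g 1|.
pose a i : R := c * (4^-1 ^+ i * (2 ^+ i) ^+ m).
have a0 i : 0 <= a i by rewrite mulr_ge0// mulr_ge0// exprn_ge0//; lra.
have s0 t : (0 <= \sum_(i <oo) ((dyadic i < t)%R%:R * a i)%:E)%E.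
  by apply: nneseries_ge0 => i _ _; rewrite lee_fin mulr_ge0.
exists B, c; split=> //; first by rewrite !addr_ge0.
have small t : `|g t| <= B -> (`|g t|%:E <= B%:E +
    \sum_(i <oo) ((dyadic i < t)%R%:R * a i)%:E)%E.
  by move=> H; apply: (@le_trans _ _ B%:E); rewrite ?lee_fin// leeDl.
move=> t /andP[t1 t2].
have [td|dt] := leP t (dyadic 1).
  apply: small.
  have tin : t \in `[-1, dyadic 1] by rewrite in_itv/= t1.
  have := pmax _ tin; have := qmin _ tin.
  have := ler_norm (g p); have := ler_norm (- g q); rewrite normrN.
  have := normr_ge0 (g p); have := normr_ge0 (g q).
  have := normr_ge0 (g 1); have := normr_ge0 (g (dyadic 1) / dyadic 1).
  by rewrite ler_norml /B => *; apply/andP; split; lra.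
move: t2; rewrite le_eqVlt => /orP[/eqP ->|t2].
  by apply: small; rewrite /B lerDr !addr_ge0.
have t0 : 0 < t by apply: lt_trans dt; rewrite d1; lra.
have [k tk] := dyadic_exceeds t2.
have := hc k t (ltW dt) tk => H.
have gt : `|g t| <= `|g t / t|.
  by rewrite normrM normfV (gtr0_norm t0) ler_pdivlMr// ler_piMr// ltW.
apply: (@le_trans _ _ (B%:E + (\sum_(i < k.+2) (dyadic i < t)%R%:R * a i)%:E)%E).
  rewrite -EFinD lee_fin; apply: (le_trans gt); apply: (le_trans H).
  by rewrite lerD2r /B; have := normr_ge0 (g p); have := normr_ge0 (g q); have := normr_ge0 (g 1); lra.
rewrite leeD2l// -sumEFin -(big_mkord xpredT (fun i => ((dyadic i < t)%R%:R * a i)%:E)).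
by apply: nneseries_lim_ge => i _; rewrite lee_fin mulr_ge0.
Qed.

(** At 1 the value of [g] is arbitrary, but a single point does not affect
measurability. *)
Lemma berg_measurable : measurable_fun (`[-1, 1]%classic : set R) g.
Proof.
rewrite (_ : (`[-1, 1]%classic : set R) = `[-1, 1[%classic `|` [set 1]); last first.
  by rewrite setUitv1// bnd_simp; lra.
apply/measurable_funU; [exact: measurable_itv|exact: measurable_set1|split].
  have [cg _ _ _] := hg.
  by apply: subspace_continuous_measurable_fun; [exact: measurable_itv|exact: cg].
exact: measurable_fun_set1.
Qed.

End dyadic.

Theorem corollary3p13 (R : realType) (n : nat) (hn : (2 <= n)%N)
    (d : nat) (hd : (2 <= d <= n.+1)%N)
    (g : R -> R) (hg : berg_function d g)
    (K : set 'rV[R]_n) (hK : convex_body K)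
    (S : nat -> {measure set 'rV[R]_n -> \bar R}) (hS : area_measures K S) :
  (S (n.+1 - d)%N).-integrable (sphere n)
    (fun v => (g (dot v (e_last n)))%:E).
Proof.
case: d hd hg => [//|m] /andP[m1 mn] hg; have m0 : (0 < m)%N by [].
case: n hn mn K hK S hS => [//|n] _ mn K hK S hS.
rewrite subSS; set j := (n.+1 - m)%N; set mu := S j.
have jn : (j < n.+1)%N by rewrite /j ltn_subrL m0.
have nj : (n.+1 - j = m)%N by rewrite /j subKn.
have mS : measurable (sphere n.+1 : set 'rV[R]_n.+1) by exact: measurable_sphere.
pose e (v : 'rV[R]_n.+1) := dot v (e_last n.+1).
have me : measurable_fun setT e by exact: measurable_dot.
have e1 v : sphere n.+1 v -> -1 <= e v <= 1.
  by move=> vS; rewrite -ler_norml /e dot_e_last; exact: sphere_coord_le1.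
have mge : measurable_fun (sphere n.+1) (g \o e).
  apply: (@measurable_comp _ _ _ _ _ _ (`[-1, 1]%classic : set R)).
  - exact: measurable_itv.
  - by move=> _ [v vS <-] /=; rewrite in_itv/=; exact: e1.
  - exact: berg_measurable hg.
  - exact: measurable_funTS.
have [B [c [B0 c0 hB]]] := berg_pointwise m0 hg.
have [V V0 hV] := area_cap_le hK hS.
pose a i : R := c * (4^-1 ^+ i * (2 ^+ i) ^+ m).
have a0 i : 0 <= a i by rewrite mulr_ge0// mulr_ge0// exprn_ge0//; lra.
have mcap i : measurable (cap n.+1 (dyadic i : R)) by exact: measurable_cap.
pose f i (v : 'rV[R]_n.+1) : \bar R := ((dyadic i < e v)%R%:R * a i)%:E.
have f0 i v : (0 <= f i v)%E by rewrite lee_fin mulr_ge0.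
have mf i : measurable_fun setT (f i).
  apply/measurable_EFinP; apply: measurable_funM => //.
  by apply: measurable_natr_bool; apply: measurable_fun_ltr.
apply/integrableP; split; first exact/measurable_EFinP.
apply: (@le_lt_trans _ _ (\int[mu]_(v in sphere n.+1) (B%:E + \sum_(i <oo) f i v))%E).
  apply: ge0_le_integral => //.
  - by apply: measurableT_comp => //; exact/measurable_EFinP.
  - apply: emeasurable_funD => //.
    apply: ge0_emeasurable_sum => //= i _; exact: measurable_funTS.
  - by move=> v /e1; exact: hB.
rewrite ge0_integralD//; last 2 first.
- by move=> v _; exact: nneseries_ge0.
- by apply: ge0_emeasurable_sum => //= i _; exact: measurable_funTS.
rewrite integral_cst// lte_add_pinfty ?lte_mul_pinfty ?lee_fin ?(area_fin hK hS)//.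
rewrite integral_nneseries//; last by move=> i; exact: measurable_funTS.
pose A : R := 2 * (c * V).
apply: (@le_lt_trans _ _ A%:E); last by rewrite ltry.
apply: le_trans (epsilon_trick0 xpredT (_ : 0 <= A)); last by rewrite !mulr_ge0.
apply: lee_nneseries => [i _ _|i _]; first exact: integral_ge0.
have -> : (\int[mu]_(v in sphere n.+1) f i v = (a i)%:E * mu (cap n.+1 (dyadic i)))%E.
  transitivity (\int[mu]_(v in sphere n.+1) ((a i)%:E * (\1_(cap n.+1 (dyadic i)) v)%:E))%E.
    apply: eq_integral => v; rewrite inE => vS; rewrite /f mulrC EFinM indicE.
    congr (_ * (nat_of_bool _)%:R%:E)%E; apply/idP/idP => [ve|]; last by rewrite inE => -[].
    by rewrite inE; split.
  rewrite ge0_integralZl//; last 2 first.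
  - by apply/measurable_EFinP; apply: measurable_indic; exact: mcap.
  - by rewrite lee_fin.
  by rewrite integral_indic// setIidl// => v [].
apply: le_trans (lee_wpmul2l _ (hV i j jn)) _; first by rewrite lee_fin.
rewrite nj -EFinM lee_fin /a /A natrX exprS.
have -> : 4^-1 ^+ i = ((2 ^+ i) ^+ 2)^-1 :> R.
  by rewrite exprVn [in RHS]exprAC -[2 ^+ 2]natrX.
have P0 : 0 < 2 ^+ i :> R by rewrite exprn_gt0.
move: (2 ^+ i) P0 => P P0; rewrite le_eqVlt; apply/orP; left; apply/eqP.
by field; rewrite expf_neq0 ?gt_eqF.
Qed.
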